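(* Let $f:\mathbb{R}^n\to[0,\infty)$, $f=e^{-\psi}$, be a nondegenerate, integrable log-concave function. Consider the problem of minimizing $$\int_{\mathbb{R}^n}e^{-\|Ax\|_2+t}\,dx$$ over all pairs $(A,t)\in\mathcal{A}\times\mathbb{R}$ satisfying $$\|Ax\|_2-t\le\psi(x)\quad\text{for all }x\in\mathbb{R}^n .$$ Then there exists a solution, unique modulo $O(n)$: there is a pair $(A_0,t_0)\in\mathcal{A}\times\mathbb{R}$ satisfying the constraint such that $$\min_{(A,t)}\int_{\mathbb{R}^n}e^{-\|Ax\|_2+t}\,dx=\int_{\mathbb{R}^n}e^{-\|A_0x\|_2+t_0}\,dx=n!\,\mathrm{vol}_n(B_2^n)\,\frac{e^{t_0}}{|\det A_0|},$$ where the minimum is over all pairs satisfying the constraint; the number $t_0$ is unique, and the affine map $A_0$ is unique up to left orthogonal transformations (i.e. if $(A,t)$ is any pair attaining the minimum, then $t=t_0$ and $A=OA_0$ for some orthogonal matrix $O$).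
   Context: A function $f:\mathbb{R}^n\to[0,\infty)$ is log-concave if $f=e^{-\psi}$ with $\psi:\mathbb{R}^n\to\mathbb{R}\cup\{\infty\}$ convex (with $e^{-\infty}=0$). It is nondegenerate if $\mathrm{int}(\mathrm{supp} f)\neq\emptyset$. $\mathcal{A}$ is the set of all invertible affine maps $Ax=Tx+a$ of $\mathbb{R}^n$ with $T\in GL(n)$, $a\in\mathbb{R}^n$; $\det A$ means $\det T$. $\|\cdot\|_2$ is the Euclidean norm, $B_2^n$ the closed Euclidean unit ball, $O(n)$ the orthogonal group. *)

(* Defs.v *)
From HB Require Import structures.
From mathcomp Require Import all_boot all_order all_algebra.
From mathcomp Require Import all_classical all_reals all_analysis.

Set Implicit Arguments.
Unset Strict Implicit.
Unset Printing Implicit Defensive.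

Import Order.TTheory GRing.Theory Num.Theory.
Import numFieldNormedType.Exports.

Local Open Scope classical_set_scope.
Local Open Scope ring_scope.

(* Lebesgue measure on R^n (vectors being columns): the n-fold product of the
   one-dimensional Borel-Lebesgue measure is built on tuples, transported to
   ['cV[R]_n], and then completed.  Completion matters: a log-concave function
   is always Lebesgue measurable, but its values on the boundary of its support
   may prevent it from being Borel measurable. *)

Section power_measure.
Context d (T : measurableType d) (R : realType).

Section cons.
Variable n : nat.

Definition tuple_cons (p : T * n.-tuple T) : n.+1.-tuple T :=
  [tuple of p.1 :: p.2].

Lemma measurable_tuple_cons : measurable_fun [set: T * n.-tuple T] tuple_cons.
Proof. exact: measurable_cons. Qed.

Variables (mu : {sigma_finite_measure set T -> \bar R})
          (nu : {sigma_finite_measure set (n.-tuple T) -> \bar R}).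
Local Open Scope ereal_scope.

Definition cons_measure : set (n.+1.-tuple T) -> \bar R :=
  pushforward (mu \x nu) tuple_cons.

Let cons_measure0 : cons_measure set0 = 0.
Proof. by rewrite /cons_measure /pushforward preimage_set0 measure0. Qed.

Let cons_measure_ge0 A : 0 <= cons_measure A.
Proof. by rewrite /cons_measure /pushforward measure_ge0. Qed.

Let cons_measure_sigma_additive : semi_sigma_additive cons_measure.
Proof.
have mcons B : measurable B -> measurable (tuple_cons @^-1` B).
  by move=> mB; rewrite -[X in measurable X]setTI; exact: measurable_tuple_cons.
move=> F mF tF mUF; rewrite /cons_measure /pushforward preimage_bigcup.
apply: measure_semi_sigma_additive; first by move=> i; exact: mcons.
  apply/trivIsetP => i j _ _ ij; rewrite -preimage_setI.
  by move/trivIsetP : tF => ->//; rewrite preimage_set0.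
by rewrite -preimage_bigcup; exact: mcons.
Qed.

HB.instance Definition _ := isMeasure.Build _ _ _ cons_measure
  cons_measure0 cons_measure_ge0 cons_measure_sigma_additive.

Let cons_measure_sigma_finite : sigma_finite setT cons_measure.
Proof.
have [F TF /all_and2[mF Foo]] : sigma_finite setT (mu \x nu).
  have /sigma_finiteP[F [TF ndF Foo]] := sigma_finiteT mu.
  have /sigma_finiteP[G [TG ndG Goo]] := sigma_finiteT nu.
  exists (fun i => F i `*` G i) => [|i].
    rewrite -setXTT TF TG predeqE => -[x y]; split.
      move=> [/= [i _ Fix] [k _ Gky]]; exists (maxn i k) => //; split.
      - by move: x Fix; exact/subsetPset/ndF/leq_maxl.
      - by move: y Gky; exact/subsetPset/ndG/leq_maxr.
    by move=> [i _ []/= ? ?]; split; exists i.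
  have [? ?] := Foo i; have [? ?] := Goo i.
  split; first exact: measurableX.
  by rewrite product_measure1E// lte_mul_pinfty// ge0_fin_numE.
pose uncons (s : n.+1.-tuple T) : T * n.-tuple T := (thead s, [tuple of behead s]).
have consK : cancel tuple_cons uncons.
  by move=> [x s]; rewrite /uncons theadE; congr pair; exact/val_inj.
have unconsK : cancel uncons tuple_cons.
  by move=> s; rewrite /tuple_cons/= -tuple_eta.
have muncons : measurable_fun setT uncons.
  apply/measurable_fun_pairP; split; first exact: measurable_tnth.
  exact: measurable_behead.
exists (fun i => uncons @^-1` F i).
  by rewrite -preimage_bigcup -TF preimage_setT.
move=> i; split.
  by rewrite -[X in measurable X]setTI; exact: muncons.
rewrite /cons_measure /pushforward -comp_preimage.
by rewrite (_ : uncons \o tuple_cons = id) ?preimage_id//; exact/funext.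
Qed.

HB.instance Definition _ := @Measure_isSigmaFinite.Build _ _ _ cons_measure
  cons_measure_sigma_finite.
End cons.

Fixpoint power_measure (mu : {sigma_finite_measure set T -> \bar R}) n :
    {sigma_finite_measure set (n.-tuple T) -> \bar R} :=
  if n is m.+1 then cons_measure mu (power_measure mu m) else \d_([tuple]).

End power_measure.

Section lebesgue_cV.
Variables (R : realType) (n : nat).

Definition cV_of_tuple (s : n.-tuple (measurableTypeR R)) : 'cV[R]_n :=
  \col_i tnth s i.

Definition tuple_of_cV (x : 'cV[R]_n) : n.-tuple (measurableTypeR R) :=
  [tuple x i ord0 | i < n].

(* A copy of ['cV[R]_n] whose measurable sets are the Borel sets. *)
Definition borel_cV := g_sigma_algebra_preimageType tuple_of_cV.

Lemma cV_of_tupleK : cancel cV_of_tuple tuple_of_cV.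
Proof. by move=> s; apply: eq_from_tnth => i; rewrite tnth_mktuple mxE. Qed.

Definition borel_lebesgue_cV : set borel_cV -> \bar R :=
  pushforward (power_measure (@lebesgue_measure R) n)
    (cV_of_tuple : n.-tuple (measurableTypeR R) -> borel_cV).

Local Open Scope ereal_scope.

Let borel_lebesgue_cV0 : borel_lebesgue_cV set0 = 0.
Proof. by rewrite /borel_lebesgue_cV /pushforward preimage_set0 measure0. Qed.

Let borel_lebesgue_cV_ge0 A : 0 <= borel_lebesgue_cV A.
Proof. by rewrite /borel_lebesgue_cV /pushforward measure_ge0. Qed.

Let borel_lebesgue_cV_sigma_additive : semi_sigma_additive borel_lebesgue_cV.
Proof.
have mcV (B : set borel_cV) : measurable B -> measurable (cV_of_tuple @^-1` B).
  move=> [C mC <-]; rewrite setTI -comp_preimage.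
  by rewrite (_ : _ \o _ = id) ?preimage_id//; exact/funext/cV_of_tupleK.
move=> F mF tF mUF; rewrite /borel_lebesgue_cV /pushforward preimage_bigcup.
apply: measure_semi_sigma_additive; first by move=> i; exact: mcV.
  apply/trivIsetP => i j _ _ ij; rewrite -preimage_setI.
  by move/trivIsetP : tF => ->//; rewrite preimage_set0.
by rewrite -preimage_bigcup; exact: mcV.
Qed.

HB.instance Definition _ := isMeasure.Build _ _ _ borel_lebesgue_cV
  borel_lebesgue_cV0 borel_lebesgue_cV_ge0 borel_lebesgue_cV_sigma_additive.

Definition lebesgue_cV :=
  @completed_measure_extension _ _ _ borel_lebesgue_cV.

HB.instance Definition _ := Measure.on lebesgue_cV.

End lebesgue_cV.
Arguments lebesgue_cV : clear implicits.

Section euclidean.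
Variables (R : realType) (n : nat).

(* The library norm on matrices is the sup norm. *)
Definition enorm (x : 'cV[R]_n) : R := Num.sqrt (\sum_i x i ord0 ^+ 2).

Definition unit_ball : set 'cV[R]_n := [set x | enorm x <= 1].

Definition orthogonal_mx (O : 'M[R]_n) : Prop := O^T *m O = 1%:M.

Record affine_iso := AffineIso {
  affine_lin : 'M[R]_n ;
  affine_trans : 'cV[R]_n ;
  affine_lin_unit : affine_lin \in unitmx }.

Definition affine_fun (A : affine_iso) (x : 'cV[R]_n) : 'cV[R]_n :=
  affine_lin A *m x + affine_trans A.

Definition affine_det (A : affine_iso) : R := \det (affine_lin A).

End euclidean.
Arguments unit_ball : clear implicits.
Arguments affine_iso : clear implicits.
Coercion affine_fun : affine_iso >-> Funclass.

Section log_concave.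
Variables (R : realType) (n : nat).
Implicit Types (f : 'cV[R]_n -> R) (psi : 'cV[R]_n -> \bar R).

(* At the endpoints t = 0 and t = 1 the convention 0 * +oo = 0 makes the
   inequality trivial, as it should be. *)
Definition convex_efun psi : Prop :=
  forall (x y : 'cV[R]_n) (t : R), 0 <= t <= 1 ->
    (psi ((1 - t) *: x + t *: y)%R <= (1 - t)%:E * psi x + t%:E * psi y)%E.

Definition log_concave_with psi f : Prop :=
  [/\ forall x, psi x != -oo%E,
      convex_efun psi &
      forall x, (f x)%:E = expeR (- psi x)%E].

Definition supp f : set 'cV[R]_n := [set x | f x != 0].

Definition nondegenerate_fun f : Prop := interior (supp f) !=set0.

Definition integrable_fun f : Prop :=
  (lebesgue_cV R n).-integrable setT (EFin \o f).

Definition admissible psi (A : affine_iso R n) (t : R) : Prop :=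
  forall x, ((enorm (A x) - t)%:E <= psi x)%E.

Definition objective (A : affine_iso R n) (t : R) : \bar R :=
  (\int[lebesgue_cV R n]_x (expR (- enorm (A x) + t))%:E)%E.

Definition minimizer psi (A : affine_iso R n) (t : R) : Prop :=
  admissible psi A t /\
  forall (B : affine_iso R n) (s : R),
    admissible psi B s -> (objective A t <= objective B s)%E.

End log_concave.

(* Main.v *)
(* By Fubini and the layer cake formula the objective equals
   n! vol(B) e^t / |det A|, so one maximizes the payoff |det A| e^-t.
   Existence: integrability and convexity force psi to grow at least linearly,
   so admissible pairs exist, while psi is bounded above on some cube, which
   confines the admissible pairs of payoff at least a given constant to a
   compact set.
   Uniqueness: let (A1, t1) and (A2, t2) be optimal. The QR decomposition gives
   an orthogonal Q such that U = Q T2 T1^-1 is upper triangular with nonnegative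
   diagonal. The pair ((A1 + Q A2) / 2, (t1 + t2) / 2) is admissible, and
   AM-GM on the diagonal of U makes its payoff too large unless the diagonal is
   identically 1; hence t1 = t2 = t and B = (A1 + Q A2) / 2 is optimal as well.
   With D = (A1 - Q A2) / 2, the parallelogram identity gives
   |B x|^2 + |D x|^2 <= (psi x + t)^2, and this slack would allow one to improve
   B unless D = 0. *)

Require Import Defs.
From HB Require Import structures.
From mathcomp Require Import all_boot all_order all_algebra.
From mathcomp Require Import all_classical all_reals all_analysis.
From mathcomp Require Import perm measurable_realfun ring lra.

Set Implicit Arguments.
Unset Strict Implicit.
Unset Printing Implicit Defensive.

Import Order.TTheory GRing.Theory Num.Theory.
Import numFieldNormedType.Exports.

Local Open Scope classical_set_scope.
Local Open Scope ring_scope.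

(** * Euclidean norm on column vectors *)

Lemma enorm_ge0 (R : realType) (n : nat) (x : 'cV[R]_n) : 0 <= enorm x.
Proof. exact: sqrtr_ge0. Qed.

Lemma enorm_sq (R : realType) (n : nat) (x : 'cV[R]_n) :
  enorm x ^+ 2 = \sum_i x i ord0 ^+ 2.
Proof. by rewrite sqr_sqrtr// sumr_ge0// => i _; rewrite sqr_ge0. Qed.

Lemma enorm_sq_mx (R : realType) (n : nat) (x : 'cV[R]_n) :
  x^T *m x = (enorm x ^+ 2)%:M.
Proof.
apply/matrixP => i j; rewrite !ord1 enorm_sq !mxE eqxx mulr1n.
by apply: eq_bigr => k _; rewrite mxE expr2.
Qed.

Lemma enorm_le (R : realType) (n : nat) (x : 'cV[R]_n) (r : R) :
  0 <= r -> (enorm x <= r) = (enorm x ^+ 2 <= r ^+ 2).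
Proof. by move=> r0; rewrite ler_sqr// nnegrE// enorm_ge0. Qed.

Lemma ler_coord_enorm (R : realType) (n : nat) (x : 'cV[R]_n) i :
  `|x i ord0| <= enorm x.
Proof.
rewrite -ler_sqr ?nnegrE ?enorm_ge0// (real_normK (num_real _)) enorm_sq (bigD1 i)//=.
by rewrite lerDl sumr_ge0// => j _; rewrite sqr_ge0.
Qed.

Lemma enorm_eq0 (R : realType) (n : nat) (x : 'cV[R]_n) : enorm x = 0 -> x = 0.
Proof.
move=> x0; apply/colP => i; rewrite mxE; apply/eqP.
by rewrite -normr_le0 -x0 ler_coord_enorm.
Qed.

Lemma enormZ (R : realType) (n : nat) (a : R) (x : 'cV[R]_n) :
  enorm (a *: x) = `|a| * enorm x.
Proof.
apply/eqP; rewrite -(@eqrXn2 _ 2)// ?mulr_ge0 ?enorm_ge0//.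
rewrite exprMn (real_normK (num_real _)) !enorm_sq mulr_sumr; apply/eqP.
by apply: eq_bigr => i _; rewrite mxE exprMn.
Qed.

Lemma enorm0 (R : realType) (n : nat) : enorm (0 : 'cV[R]_n) = 0.
Proof. by rewrite -(scale0r 0) enormZ normr0 mul0r. Qed.

Lemma parallelogram (R : realType) (n : nat) (x y : 'cV[R]_n) :
  enorm (x + y) ^+ 2 + enorm (x - y) ^+ 2 =
  2 * enorm x ^+ 2 + 2 * enorm y ^+ 2.
Proof.
rewrite !enorm_sq !mulr_sumr -!big_split/=.
by apply: eq_bigr => i _; rewrite !mxE; ring.
Qed.

Lemma ler_enormD (R : realType) (n : nat) (x y : 'cV[R]_n) :
  enorm (x + y) <= enorm x + enorm y.
Proof.
have [/enorm_eq0->|x0] := eqVneq (enorm x) 0; first by rewrite add0r lerDr enorm_ge0.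
have [/enorm_eq0->|y0] := eqVneq (enorm y) 0; first by rewrite addr0 lerDl enorm_ge0.
have {}x0 : 0 < enorm x by rewrite lt_neqAle eq_sym x0 enorm_ge0.
have {}y0 : 0 < enorm y by rewrite lt_neqAle eq_sym y0 enorm_ge0.
rewrite enorm_le ?addr_ge0 ?enorm_ge0//.
pose l := enorm y / enorm x; have l0 : 0 < l by rewrite divr_gt0.
(* Young's inequality with the optimal weight l replaces Cauchy-Schwarz. *)
have -> : (enorm x + enorm y) ^+ 2 =
    (1 + l) * enorm x ^+ 2 + (1 + l^-1) * enorm y ^+ 2.
  by rewrite /l; field; rewrite !gt_eqF.
rewrite !enorm_sq !mulr_sumr -big_split/= ler_sum// => i _.
rewrite mxE -subr_ge0.
have -> : (1 + l) * x i ord0 ^+ 2 + (1 + l^-1) * y i ord0 ^+ 2 -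
    (x i ord0 + y i ord0) ^+ 2 = l^-1 * (l * x i ord0 - y i ord0) ^+ 2.
  by field; rewrite gt_eqF.
by rewrite mulr_ge0 ?sqr_ge0// invr_ge0 ltW.
Qed.

(** The crude factor [n] is enough for qualitative bounds. For [n = 0] the hypothesis says nothing
    about the sign of [r], hence the case split. *)
Lemma ler_enorm_sum (R : realType) (n : nat) (x : 'cV[R]_n) (r : R) :
  (forall i, `|x i ord0| <= r) -> enorm x <= n%:R * r.
Proof.
case: n x => [|n] x xr.
  by rewrite mul0r (_ : x = 0) ?enorm0//; apply/colP => -[].
have r0 : 0 <= r by exact: le_trans (xr ord0).
rewrite enorm_le ?mulr_ge0// enorm_sq.
apply: (@le_trans _ _ (\sum_(i < n.+1) r ^+ 2)).
  by apply: ler_sum => i _; rewrite -(real_normK (num_real _)) ler_sqr ?nnegrE.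
rewrite sumr_const card_ord exprMn -[leLHS]mulr_natl.
by apply: ler_wpM2r; rewrite ?sqr_ge0// expr2 ler_peMr// ler1n.
Qed.

(** * Orthogonal matrices, Householder reflections and the QR decomposition *)

Section orthogonal.
Context {R : realType} {n : nat}.
Implicit Types O P : 'M[R]_n.

Lemma orthogonal1 : orthogonal_mx (1%:M : 'M[R]_n).
Proof. by rewrite /orthogonal_mx trmx1 mulmx1. Qed.

Lemma orthogonalM O P :
  orthogonal_mx O -> orthogonal_mx P -> orthogonal_mx (O *m P).
Proof.
rewrite /orthogonal_mx => hO hP.
by rewrite trmx_mul -mulmxA (mulmxA O^T) hO mul1mx.
Qed.

Lemma orthogonal_unit O : orthogonal_mx O -> O \in unitmx.
Proof. by move=> /mulmx1_unit[]. Qed.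

Lemma orthogonal_det O : orthogonal_mx O -> `|\det O| = 1.
Proof.
move=> /(congr1 determinant); rewrite det_mulmx det_tr det1 => h.
by apply/eqP; rewrite -(@eqrXn2 _ 2)// (real_normK (num_real _)) expr2 h expr1n.
Qed.

Lemma orthogonal_enorm O (x : 'cV[R]_n) :
  orthogonal_mx O -> enorm (O *m x) = enorm x.
Proof.
move=> hO; apply/eqP; rewrite -(@eqrXn2 _ 2)// ?enorm_ge0//; apply/eqP.
have := enorm_sq_mx (O *m x); rewrite trmx_mul mulmxA -(mulmxA x^T) hO mulmx1.
by rewrite enorm_sq_mx => /matrixP/(_ ord0 ord0); rewrite !mxE eqxx !mulr1n.
Qed.

End orthogonal.

(** The reflection in the hyperplane orthogonal to the difference [w] of two vectors of equal norm
    exchanges them; the computation rests on [w^T v = |w|^2 / 2]. If [w = 0], the identity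
    serves. *)
Lemma householder (R : realType) (n : nat) (v : 'cV[R]_n.+1) :
  exists2 O, orthogonal_mx O & O *m v = enorm v *: delta_mx ord0 ord0.
Proof.
have [w wE] : {w | w = v - enorm v *: delta_mx ord0 ord0} by eexists.
pose q := enorm w ^+ 2.
have [w0|w0] := eqVneq w 0.
  exists 1%:M; first exact: orthogonal1.
  by rewrite mul1mx; apply/eqP; rewrite -subr_eq0 -wE w0.
have q0 : q != 0 by rewrite sqrf_eq0; apply: contra_neq w0; exact: enorm_eq0.
have wT : w^T = v^T - enorm v *: (delta_mx ord0 ord0)^T.
  by rewrite wE linearB/= linearZ.
have wv : w^T *m v = (q / 2)%:M.
  have e0 : (delta_mx ord0 ord0)^T *m v = (v ord0 ord0)%:M.
    by rewrite trmx_delta -rowE; apply/matrixP => i j; rewrite !ord1 !mxE eqxx.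
  have e1 : v^T *m (delta_mx ord0 ord0 : 'cV_n.+1) = (v ord0 ord0)%:M.
    by rewrite -[LHS]trmxK trmx_mul trmxK e0 tr_scalar_mx.
  have ee : (delta_mx ord0 ord0)^T *m (delta_mx ord0 ord0 : 'cV[R]_n.+1) = 1%:M.
    rewrite trmx_delta mul_delta_mx.
    by apply/matrixP => i j; rewrite !ord1 !mxE eqxx.
  have -> : q = 2 * (enorm v ^+ 2 - enorm v * v ord0 ord0).
    have := enorm_sq_mx w; rewrite wT {1}wE mulmxBl !mulmxBr.
    rewrite -!scalemxAl -!scalemxAr e0 e1 ee enorm_sq_mx.
    move/matrixP => /(_ ord0 ord0); rewrite !mxE eqxx !mulr1n -/q => <-; ring.
  rewrite wT mulmxBl -!scalemxAl e0 enorm_sq_mx.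
  by rewrite scale_scalar_mx -raddfB/=; congr (_%:M); field.
have ww : w^T *m w = q%:M by rewrite enorm_sq_mx.
exists (1%:M - (2 / q) *: (w *m w^T)).
  rewrite /orthogonal_mx.
  have -> : (1%:M - (2 / q) *: (w *m w^T))^T = 1%:M - (2 / q) *: (w *m w^T).
    by rewrite linearB/= linearZ/= trmx1 trmx_mul trmxK.
  rewrite mulmxBr mulmx1 mulmxBl mul1mx -scalemxAl -scalemxAr -mulmxA.
  rewrite (mulmxA w^T) ww mul_scalar_mx -scalemxAr.
  rewrite !scalerA (_ : 2 / q * (2 / q * q) = 2 / q + 2 / q); last by field.
  by rewrite scalerDl opprB addrK subrK.
rewrite mulmxBl mul1mx -scalemxAl -mulmxA wv mul_mx_scalar scalerA.
rewrite (_ : 2 / q * (q / 2) = 1); last by field.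
by rewrite scale1r wE subKr.
Qed.

(* The recursive formulation matches the coordinate-by-coordinate use of
   Fubini's theorem in the change of variables formula. *)
Fixpoint nonneg_upper (R : realType) (n : nat) : 'M[R]_n -> Prop :=
  if n is m.+1 then fun U : 'M[R]_(1 + m) =>
    [/\ 0 <= U ord0 ord0, dlsubmx U = 0 & @nonneg_upper R m (drsubmx U)]
  else fun=> True.
Arguments nonneg_upper {R n}.

(** Induction on the dimension: a Householder reflection clears the first column below the diagonal,
    and the induction hypothesis treats the lower right block. *)
Lemma qr_decomposition (R : realType) (n : nat) (T : 'M[R]_n) :
  exists2 O, orthogonal_mx O & nonneg_upper (O *m T).
Proof.
elim: n T => [|n IH] T; first by exists 1%:M; first exact: orthogonal1.
have [H oH HT] := householder (col ord0 T).
have [S SE] : {S : 'M[R]_(1 + n) | S = H *m T} by eexists.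
have [P oP uP] := IH (drsubmx S).
pose Q : 'M[R]_(1 + n) := block_mx 1%:M 0 0 P.
have oQ : orthogonal_mx Q.
  rewrite /orthogonal_mx /Q tr_block_mx mulmx_block !trmx0 !mulmx0 !mul0mx.
  by rewrite !addr0 !add0r trmx1 mul1mx oP -scalar_mx_block.
exists (Q *m H); first exact: orthogonalM oH.
have colS : col ord0 S = enorm (col ord0 T) *: delta_mx ord0 ord0.
  by rewrite -HT SE !colE mulmxA.
have S0 i : S i ord0 = (enorm (col ord0 T)) * (i == ord0)%:R.
  by move/matrixP : colS => /(_ i ord0); rewrite !mxE eqxx andbT.
have dlS : dlsubmx S = 0.
  apply/matrixP => i j; rewrite !mxE !ord1.
  rewrite [lshift _ _](_ : _ = ord0); last exact/val_inj.
  by rewrite S0/= mulr0.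
have QS : Q *m S = block_mx (ulsubmx S) (ursubmx S) 0 (P *m drsubmx S).
  rewrite -[in LHS](submxK S) dlS /Q mulmx_block.
  by rewrite !mul1mx !mul0mx !addr0 !mulmx0 !add0r.
rewrite -mulmxA -SE QS /=.
split; last by rewrite block_mxKdr.
- have -> : (ord0 : 'I_(1 + n)) = lshift n ord0 by exact/val_inj.
  rewrite block_mxEul !mxE.
  rewrite [lshift _ _](_ : _ = ord0); last exact/val_inj.
  by rewrite S0 mulr1 enorm_ge0.
- by rewrite block_mxKdl.
Qed.

Lemma nonneg_upper_detS (R : realType) (n : nat) (U : 'M[R]_(1 + n)) :
  dlsubmx U = 0 -> \det U = U ord0 ord0 * \det (drsubmx U).
Proof.
move=> U0; rewrite -{1}[U]submxK U0 det_ublock det_mx11; congr (_ * _).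
by rewrite !mxE; congr (U _ _); exact/val_inj.
Qed.

(** Each diagonal entry satisfies [4 u <= (1 + u)^2], with equality only at [u = 1]. The bound
    [1 <= \det (1%:M + U)] is carried through the induction so that this factor can be cancelled. *)
Lemma nonneg_upper_detD1 (R : realType) (n : nat) (U : 'M[R]_n) :
  nonneg_upper U ->
  [/\ 0 <= \det U, 1 <= \det (1%:M + U), 4 ^+ n * \det U <= \det (1%:M + U) ^+ 2 &
    0 < \det U -> 4 ^+ n * \det U = \det (1%:M + U) ^+ 2 -> \det U = 1].
Proof.
elim: n U => [U _|n IH U [u0 dU /IH[d0 d1 le_d eq_d]]].
  by rewrite !det_mx00 expr0 expr1n mulr1 ler01 lexx.
have dU1 : dlsubmx (1%:M + U : 'M[R]_(1 + n)) = 0.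
  apply/matrixP => i j; move/matrixP: dU => /(_ i j); rewrite !mxE => ->.
  by rewrite addr0 (ord1 j).
have dU2 : drsubmx (1%:M + U : 'M[R]_(1 + n)) = 1%:M + drsubmx (U : 'M[R]_(1 + n)).
  by apply/matrixP => i j; rewrite !mxE (inj_eq (@rshift_inj 1 n)).
have -> : \det (1%:M + U) =
    (1 + U ord0 ord0) * \det (1%:M + drsubmx (U : 'M[R]_(1 + n))).
  by rewrite (nonneg_upper_detS dU1) !mxE eqxx dU2.
rewrite (nonneg_upper_detS dU).
set u := U _ _ in u0 *; set d := \det _ in d0 le_d eq_d *.
set e := \det _ in d1 le_d eq_d *.
have e0 : 0 < e ^+ 2 by rewrite exprn_gt0// (lt_le_trans ltr01).
have u4 : 4 * u <= (1 + u) ^+ 2.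
  by rewrite -subr_ge0 (_ : _ - _ = (1 - u) ^+ 2) ?sqr_ge0//; ring.
have eE : 4 ^+ n.+1 * (u * d) = (4 * u) * (4 ^+ n * d) by rewrite exprS; ring.
rewrite eE exprMn; split.
- exact: mulr_ge0.
- by rewrite mulr_ege1// lerDl.
- by rewrite ler_pM// mulr_ge0// exprn_ge0.
- move=> ud; have u_gt0 : 0 < u.
    by rewrite lt_neqAle u0 andbT eq_sym;
      apply: contraTneq ud => ->; rewrite mul0r ltxx.
  have d_gt0 : 0 < d by move: ud; rewrite pmulr_rgt0.
  move=> h.
  (* The remaining factors satisfy [4^n d <= e^2], so equality of the products forces equality for
     the corner entry. *)
  have eq_u : 4 * u = (1 + u) ^+ 2.
    apply/eqP; rewrite eq_le u4/=.
    rewrite -(ler_pM2r e0) -h ler_wpM2l// mulr_ge0//.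
  have u1 : u = 1.
    have : (1 - u) ^+ 2 = 0.
      by rewrite (_ : _ ^+ 2 = (1 + u) ^+ 2 - 4 * u); [rewrite eq_u subrr|ring].
    by move/eqP; rewrite sqrf_eq0 subr_eq0 => /eqP.
  rewrite u1 mul1r eq_d//.
  apply: (@mulfI _ (4 * u)); first by rewrite mulf_neq0// gt_eqF.
  by rewrite h eq_u.
Qed.

(** * Affine changes of variables for the product Lebesgue measure *)

Section lebesgue_affine1.
Context {R : realType}.
Local Open Scope ereal_scope.
Notation lam := (@lebesgue_measure R).

(** Multiplied by [u], the image of Lebesgue measure under [x |-> u x + b] gives every half-open
    interval its length, so uniqueness identifies it with Lebesgue measure. *)
Lemma ge0_integral_lebesgue_affine (u b : R) (g : measurableTypeR R -> \bar R) :
  (0 < u)%R -> measurable_fun setT g -> (forall x, 0 <= g x) ->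
  \int[lam]_x g (u * x + b)%R = (u^-1)%:E * \int[lam]_x g x.
Proof.
move=> u0 mg g0.
have maff : measurable_fun [set: measurableTypeR R]
    (fun x => u * x + b : measurableTypeR R)%R.
  apply: measurable_funD; last exact: measurable_cst.
  by apply: measurable_funM => //; exact: measurable_cst.
have u'0 : (0 <= u^-1)%R by rewrite invr_ge0 ltW.
transitivity (\int[pushforward lam
    (fun x => u * x + b : measurableTypeR R)%R]_x g x).
  rewrite ge0_integral_pushforward// preimage_setT//.
transitivity (\int[mscale (NngNum u'0) lam]_x g x); last first.
  by rewrite ge0_integral_mscale.
apply: eq_measure_integral => A mA _.
rewrite [RHS](_ : _ = (u^-1)%:E * lam A)//.
rewrite (@lebesgue_measure_unique _
  (mscale (NngNum (ltW u0))
    (pushforward lam (fun x => u * x + b : measurableTypeR R)%R)))//=.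
  rewrite /mscale/= muleA -EFinM mulVf ?mul1e// gt_eqF//.
move=> _ [[c d]] _ <-; rewrite /mscale/= /pushforward.
rewrite (_ : _ @^-1` _ = [set` `](c - b) / u, (d - b) / u]%R]); last first.
  apply/seteqP; split => x/=; rewrite !in_itv/= ltr_pdivrMr// ler_pdivlMr//.
    by move=> /andP[? ?]; apply/andP; split; lra.
  by move=> /andP[? ?]; apply/andP; split; lra.
rewrite !lebesgue_measure_itv/= !lte_fin ltr_pM2r ?invr_gt0// ltrD2r.
case: ifPn => _; last by rewrite mule0.
rewrite -!EFinB -EFinM; congr EFin; field; exact: lt0r_neq0.
Qed.

End lebesgue_affine1.

Section power_lebesgue.
Context {R : realType}.
Local Open Scope ereal_scope.
Notation lam := (@lebesgue_measure R).
Notation pow n := (power_measure lam n).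
Notation TR := (measurableTypeR R).

(** Tonelli with the head coordinate innermost: for a fixed tail, an upper triangular map acts on
    the head as a one-dimensional affine map. *)
Lemma ge0_integral_power_cons (n : nat) (g : n.+1.-tuple TR -> \bar R) :
  measurable_fun setT g -> (forall s, 0 <= g s) ->
  \int[pow n.+1]_s g s = \int[pow n]_s \int[lam]_x g (tuple_cons (x, s)).
Proof.
move=> mg g0.
transitivity (\int[pushforward (lam \x pow n) (@tuple_cons _ TR n)]_s g s).
  by apply: eq_measure_integral => //; exact: measurable_tuple_cons.
rewrite ge0_integral_pushforward//; last exact: measurable_tuple_cons.
rewrite ?preimage_setT fubini_tonelli2//.
- by apply: measurableT_comp => //; exact: measurable_tuple_cons.
- by move=> z; exact: g0.
Qed.

Definition affine_tuple (n : nat) (U : 'M[R]_n) (b : 'cV[R]_n)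
  (s : n.-tuple TR) : n.-tuple TR := tuple_of_cV (U *m cV_of_tuple s + b)%R.

Lemma measurable_mulmx_coord (m n : nat) (U : 'M[R]_(m, n)) (b : 'cV[R]_m) i :
  measurable_fun setT (fun s : n.-tuple TR => ((U *m cV_of_tuple s + b) i ord0)%R : TR).
Proof.
rewrite (_ : (fun _ => _) = (fun s : n.-tuple TR =>
    (\sum_j U i j * tnth s j) + b i ord0))%R; last first.
  by apply/funext => s; rewrite !mxE; under eq_bigr do rewrite mxE.
apply: measurable_funD; last exact: measurable_cst.
apply: (@measurable_sum _ _ R setT _ _ (fun j (s : n.-tuple TR) => U i j * tnth s j)%R).
move=> j; apply: measurable_funM; first exact: measurable_cst.
exact: measurable_tnth.
Qed.

Lemma measurable_affine_tuple (n : nat) (U : 'M[R]_n) (b : 'cV[R]_n) :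
  measurable_fun setT (affine_tuple U b).
Proof.
apply/measurable_fun_tnthP => i.
rewrite (_ : _ \o _ = fun s : n.-tuple TR => ((U *m cV_of_tuple s + b) i ord0)%R : TR).
  exact: measurable_mulmx_coord.
by apply/funext => s; rewrite /= tnth_mktuple.
Qed.

Lemma affine_tuple_cons (n : nat) (U : 'M[R]_(1 + n)) (b : 'cV[R]_(1 + n))
    (x : TR) (s : n.-tuple TR) : dlsubmx U = 0%R ->
  affine_tuple (n := n.+1) U b (tuple_cons (x, s)) =
  tuple_cons (U ord0 ord0 * x + (ursubmx U *m cV_of_tuple s + usubmx b) ord0 ord0,
    affine_tuple (drsubmx U) (dsubmx b) s)%R.
Proof.
move=> U0; have l0 : lshift n ord0 = ord0 :> 'I_(1 + n) by exact/val_inj.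
have rS j : rshift 1 j = lift ord0 j :> 'I_(1 + n) by exact/val_inj.
apply: eq_from_tnth => i; rewrite tnth_mktuple !mxE big_ord_recl !mxE.
rewrite /tuple_cons/= tnth0.
under eq_bigr do rewrite mxE tnthS.
case: (unliftP ord0 i) => [j ->|->]; last first.
  rewrite tnth0 ?mxE l0 addrA; congr (_ + _ + _)%R.
  by apply: eq_bigr => j _; rewrite !mxE l0 rS.
rewrite tnthS tnth_mktuple !mxE.
have := U0 => /matrixP/(_ j ord0); rewrite !mxE rS l0 => ->.
rewrite mul0r add0r; congr (_ + _)%R.
by apply: eq_bigr => k _; rewrite !mxE !rS.
Qed.

(** For a fixed tail the head is scaled by the corner entry of [U] and shifted by an amount
    depending only on the tail. Integrating the head out leaves a function [G] of the tail, to which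
    the induction hypothesis for the lower right block applies. *)
Lemma ge0_integral_upper_affine (n : nat) (U : 'M[R]_n) (b : 'cV[R]_n)
    (g : n.-tuple TR -> \bar R) :
  nonneg_upper U -> (0 < \det U)%R ->
  measurable_fun setT g -> (forall s, 0 <= g s) ->
  \int[pow n]_s g (affine_tuple U b s) = ((\det U)^-1)%:E * \int[pow n]_s g s.
Proof.
elim: n U b g => [|n IH] U b g.
  move=> _ _ mg g0; rewrite det_mx00 invr1 mul1e.
  by apply: eq_integral => s _; congr g; rewrite [LHS]tuple0 [RHS]tuple0.
move=> [u0 U0 uU]; rewrite (nonneg_upper_detS U0) => detU mg g0.
have u_gt0 : (0 < U ord0 ord0)%R.
  by rewrite lt_neqAle u0 andbT eq_sym;
    apply: contraTneq detU => ->; rewrite mul0r ltxx.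
have {detU} d_gt0 : (0 < \det (drsubmx (U : 'M[R]_(1 + n))))%R.
  by move: detU; rewrite pmulr_rgt0.
have mcons (s : n.-tuple TR) :
    measurable_fun setT (fun x : TR => tuple_cons (x, s)).
  by apply: (measurableT_comp (@measurable_tuple_cons _ TR n)).
rewrite [LHS]ge0_integral_power_cons//; last first.
  by apply: measurableT_comp => //; exact: measurable_affine_tuple.
pose G (s : n.-tuple TR) := \int[lam]_x g (tuple_cons (x, s)).
transitivity (\int[pow n]_s ((U ord0 ord0)^-1%:E *
    G (affine_tuple (drsubmx (U : 'M[R]_(1 + n))) (dsubmx (b : 'cV[R]_(1 + n))) s))).
  apply: eq_integral => s _.
  under eq_integral do rewrite (affine_tuple_cons _ _ _ U0).
  rewrite (ge0_integral_lebesgue_affine _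
    (g := fun x => g (tuple_cons (x, affine_tuple _ _ s))))//.
  by apply: measurableT_comp => //; exact: mcons.
have mG : measurable_fun setT G.
  apply: (measurable_fun_fubini_tonelli_G (m1 := lam)
    (fun z => g (tuple_cons z))).
  - by apply: measurableT_comp => //; exact: measurable_tuple_cons.
  - by move=> z; exact: g0.
have G0 s : 0 <= G s by apply: integral_ge0 => x _; exact: g0.
rewrite ge0_integralZl//; first last.
- by rewrite lee_fin invr_ge0 ltW.
- by apply: measurableT_comp => //; exact: measurable_affine_tuple.
rewrite IH// muleA -EFinM -invfM; congr (_ * _).
by rewrite [RHS]ge0_integral_power_cons.
Qed.

Lemma measurable_power_cube (n : nat) (a : 'I_n -> R) (r : R) :
  measurable [set s : n.-tuple TR | forall i, `|tnth s i - a i| <= r]%R.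
Proof.
rewrite (_ : mkset _ = \bigcap_i
    [set s : n.-tuple TR | `|tnth s i - a i| <= r]%R); last first.
  by apply/seteqP; split => s h i //=; exact: h.
apply: fin_bigcap_measurable => // i _.
rewrite -[X in measurable X]setTI.
rewrite (_ : mkset _ = (fun s : n.-tuple TR => tnth s i) @^-1`
  [set` `[a i - r, a i + r]%R]).
  exact: measurable_tnth.
by apply/seteqP; split => s /=; rewrite in_itv/= ler_distl.
Qed.

(** The degenerate case [r = 0] is included since it shows that a point is null in positive
    dimension. *)
Lemma power_lebesgue_cube (n : nat) (a : 'I_n -> R) (r : R) : (0 <= r)%R ->
  pow n [set s | forall i, `|tnth s i - a i| <= r]%R = ((2 * r) ^+ n)%:E.
Proof.
move=> r0; elim: n a => [|n IH] a.
  by rewrite expr0 /= diracE mem_set// => -[].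
have mcube := @measurable_power_cube n (fun i => a (lift ord0 i)) r.
rewrite /= /cons_measure /pushforward.
rewrite (_ : _ @^-1` _ = [set` `[a ord0 - r, a ord0 + r]%R] `*`
  [set s : n.-tuple TR | forall i, `|tnth s i - a (lift ord0 i)| <= r]%R).
  rewrite product_measure1E// (IH (fun i => a (lift ord0 i))).
  rewrite /= lebesgue_measure_itv/= lte_fin exprS.
  case: ltP => hr; first by rewrite -EFinB -EFinM; congr EFin; ring.
  have -> : (r = 0)%R by apply/eqP; rewrite eq_le r0 andbT; lra.
  by rewrite mulr0 !mul0r mul0e.
apply/seteqP; split => -[x s]/=; rewrite /tuple_cons/=.
  move=> h; split; first by have := h ord0; rewrite tnth0 in_itv/= ler_distl.
  by move=> i; have := h (lift ord0 i); rewrite tnthS.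
rewrite in_itv/= => -[h0 h] i; case: (unliftP ord0 i) => [j ->|->].
  by rewrite tnthS.
by rewrite tnth0 ler_distl.
Qed.

End power_lebesgue.

Section lebesgue_cV_transfer.
Context {R : realType} {n : nat}.
Local Open Scope ereal_scope.
Notation lam := (@lebesgue_measure R).
Notation pow n := (power_measure lam n).
Notation TR := (measurableTypeR R).
Notation LV := (caratheodory_type (@borel_lebesgue_cV R n)^*%mu).

Lemma measurable_cV_of_tuple_preimage (A : set 'cV[R]_n) :
  measurable (@cV_of_tuple R n @^-1` A) -> measurable (A : set (borel_cV R n)).
Proof.
move=> mA; exists (@cV_of_tuple R n @^-1` A) => //; rewrite setTI.
rewrite -comp_preimage (_ : _ \o _ = id) ?preimage_id//.
by apply/funext => x; apply/colP => i; rewrite /= mxE tnth_mktuple.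
Qed.

Lemma lebesgue_cV_measurable (A : set 'cV[R]_n) :
  measurable (@cV_of_tuple R n @^-1` A) -> measurable (A : set LV).
Proof.
move=> mA; apply: caratheodory_measurable_mu_ext.
exact: measurable_cV_of_tuple_preimage.
Qed.

(** The completion agrees with the original measure on Borel sets, so explicit volumes can be
    computed on tuples. *)
Lemma lebesgue_cVE (A : set 'cV[R]_n) : measurable (@cV_of_tuple R n @^-1` A) ->
  lebesgue_cV R n A = pow n (@cV_of_tuple R n @^-1` A).
Proof.
move=> mA; rewrite /lebesgue_cV /completed_measure_extension.
by rewrite measurable_mu_extE//; exact: measurable_cV_of_tuple_preimage.
Qed.

End lebesgue_cV_transfer.

(** * Incomplete gamma integrals *)

Section gamma.
Context {R : realType}.

(** The antiderivative of [x^n e^-x] produced by repeated integration by parts; it is minus the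
    upper incomplete gamma function of order [n + 1]. *)
Fixpoint gamma_primitive (n : nat) (x : R) : R :=
  if n is m.+1 then m.+1%:R * gamma_primitive m x - x ^+ m.+1 * expR (- x)
  else - expR (- x).

Lemma is_derive_gamma_primitive (n : nat) (x : R) :
  is_derive x 1 (gamma_primitive n) (x ^+ n * expR (- x)).
Proof.
have de : is_derive x 1 (fun y : R => expR (- y)) (- expR (- x)).
  by rewrite -mulrN1; exact: (@is_derive1_comp _ expR -%R).
have dx m : is_derive x 1 (fun y : R => y ^+ m.+1) (m.+1%:R * x ^+ m).
  have := @is_deriveX _ _ id m.+1 x 1 1 (is_derive_id _ _).
  by rewrite exprfctE /GRing.scale/= mulr1.
elim: n => [|n IH] /=.
  by have := is_deriveN de; rewrite opprK expr0 mul1r.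
have := is_deriveB (is_deriveZ n.+1%:R IH) (is_deriveM (dx n) de).
by rewrite /GRing.scale/=; congr is_derive; rewrite exprS; ring.
Qed.

Lemma gamma_primitive0 (n : nat) : gamma_primitive n 0 = - n`!%:R.
Proof.
elim: n => [|n IH] /=; first by rewrite oppr0 expR0 fact0.
by rewrite IH expr0n mul0r subr0 factS natrM mulrN.
Qed.

(** For [x > 0] the Taylor term [x^(n+1) / (n+1)!] is below [e^x], so the product is at most
    [(n+1)! / x]. *)
Lemma cvg_exprn_expRN (n : nat) : x ^+ n * expR (- x) @[x --> +oo] --> (0 : R).
Proof.
apply: (@squeeze_cvgr _ _ _ _ (fun=> 0) (fun x : R => n.+1`!%:R * x^-1)).
- near=> x; have x0 : 0 < x by near: x; exact: nbhs_pinfty_gt.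
  rewrite mulr_ge0 ?expR_ge0 ?exprn_ge0 ?(ltW x0)//=.
  rewrite expRN ler_pdivrMr ?expR_gt0// mulrAC ler_pdivlMr//.
  have := expR_ge1Dxn n (ltW x0); rewrite -exprSr => h.
  have f0 : 0 < n.+1`!%:R :> R by rewrite ltr0n fact_gt0.
  rewrite mulrC -ler_pdivrMr//; apply: le_trans h; by rewrite lerDr.
- exact: cvg_cst.
- rewrite -(mulr0 n.+1`!%:R); apply: cvgMr.
  apply/gtr0_cvgV0; first by near=> x; near: x; exact: nbhs_pinfty_gt.
  exact: cvg_id.
Unshelve. all: by end_near. Qed.

Lemma cvg_gamma_primitive (n : nat) : gamma_primitive n x @[x --> +oo] --> (0 : R).
Proof.
elim: n => [|n IH] /=; first by rewrite -oppr0; apply: cvgN; exact: cvgr_expR.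
rewrite -[X in _ --> X]subr0 -[X in X - _](mulr0 n.+1%:R).
apply: cvgB; last exact: cvg_exprn_expRN.
exact: cvgMr.
Qed.

(** The layer cake computation needs two instances: exponent 0 from [a = |x|], and the dimension as
    exponent from [a = 0], where the value is [n!]. *)
Lemma integral_exprn_expRN (n : nat) (a : R) : 0 <= a ->
  (\int[@lebesgue_measure R]_(x in `[a, +oo[) (x ^+ n * expR (- x))%:E =
   (- gamma_primitive n a)%:E)%E.
Proof.
move=> a0.
have cF : continuous (gamma_primitive n).
  move=> x; apply: differentiable_continuous; apply/derivable1_diffP.
  by have [] := is_derive_gamma_primitive n x.
rewrite (@ge0_continuous_FTC2y _ _ (gamma_primitive n) a 0)//.
- by rewrite -EFinB sub0r.
- by move=> x ax; rewrite mulr_ge0 ?expR_ge0// exprn_ge0// (le_trans a0).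
- apply: continuous_subspaceT => x; apply: cvgM; first exact: exprn_continuous.
  apply: continuous_comp; first exact: continuousN.
  exact: continuous_expR.
- exact: cvg_gamma_primitive.
- by move=> x _; have [] := is_derive_gamma_primitive n x.
- exact/cvg_at_right_filter/cF.
- move=> x _; rewrite derive1E; have dx := is_derive_gamma_primitive n x.
  exact: derive_val.
Qed.

End gamma.

(** * Evaluation of the objective *)

Lemma nonneg_upper_scalar (R : realType) (n : nat) (a : R) :
  0 <= a -> nonneg_upper (a%:M : 'M[R]_n).
Proof.
move=> a0; elim: n => [//|n IH] /=; split.
- by rewrite mxE eqxx.
- by rewrite (scalar_mx_block 1) block_mxKdl.
- by rewrite (scalar_mx_block 1) block_mxKdr.
Qed.

(** An integral depends only on the values of the measure on measurable sets, so [nu] may be any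
    measure agreeing there with the pushforward. *)
Lemma ge0_integral_image d1 d2 (X : measurableType d1) (Y : measurableType d2)
    (R : realType) (mu : {measure set X -> \bar R})
    (nu : {measure set Y -> \bar R}) (phi : X -> Y) (g : Y -> \bar R) :
  measurable_fun setT phi ->
  (forall B, measurable B -> mu (phi @^-1` B) = nu B) ->
  measurable_fun setT g -> (forall y, (0 <= g y)%E) ->
  (\int[nu]_y g y = \int[mu]_x g (phi x))%E.
Proof.
move=> mphi munu mg g0.
have <- := @ge0_integral_pushforward _ _ _ _ _ _ mphi mu setT g measurableT mg
  (fun y _ => g0 y).
by apply: eq_measure_integral => B mB _; exact/esym/munu.
Qed.

Section norm_integral.
Context {R : realType} {n : nat}.
Local Open Scope ereal_scope.
Notation lam := (@lebesgue_measure R).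
Notation pow n := (power_measure lam n).
Notation TR := (measurableTypeR R).
Notation LV := (caratheodory_type (@borel_lebesgue_cV R n)^*%mu).

Lemma measurable_tuple_of_cV :
  measurable_fun setT (@tuple_of_cV R n : LV -> n.-tuple TR).
Proof.
move=> _ B mB; rewrite setTI; apply: lebesgue_cV_measurable.
rewrite -comp_preimage (_ : _ \o _ = id) ?preimage_id//.
by apply/funext => s /=; rewrite cV_of_tupleK.
Qed.

Lemma ge0_integral_lebesgue_cV (g : 'cV[R]_n -> \bar R) :
  measurable_fun setT (g \o @cV_of_tuple R n) -> (forall x, 0 <= g x) ->
  \int[lebesgue_cV R n]_x g x = \int[pow n]_s g (cV_of_tuple s).
Proof.
move=> mg g0.
rewrite (ge0_integral_image (mu := lebesgue_cV R n) measurable_tuple_of_cV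
    (nu := pow n) (g := g \o @cV_of_tuple R n))//.
- apply: eq_integral => x _ /=; congr g.
  by apply/colP => i; rewrite mxE tnth_mktuple.
- move=> B mB.
  have KB : @cV_of_tuple R n @^-1` (@tuple_of_cV R n @^-1` B) = B.
    rewrite -comp_preimage (_ : _ \o _ = id) ?preimage_id//.
    by apply/funext => s /=; rewrite cV_of_tupleK.
  by apply: etrans (lebesgue_cVE _) _; rewrite KB.
- by move=> s /=; exact: g0.
Qed.

Lemma measurable_enorm_affine (U : 'M[R]_n) (b : 'cV[R]_n) :
  measurable_fun setT (fun s : n.-tuple TR => enorm (U *m cV_of_tuple s + b)%R : TR).
Proof.
apply: (measurableT_comp (continuous_measurable_fun (@sqrt_continuous R))).
apply: (@measurable_sum _ _ R setT _ _
  (fun i (s : n.-tuple TR) => (U *m cV_of_tuple s + b)%R i ord0 ^+ 2)%R) => i.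
by apply: measurable_funX; exact: measurable_mulmx_coord.
Qed.

Lemma measurable_enorm :
  measurable_fun setT (fun s : n.-tuple TR => enorm (cV_of_tuple s) : TR).
Proof.
have := measurable_enorm_affine 1%:M 0.
by under eq_fun do rewrite mul1mx addr0.
Qed.

Let eball (r : R) : set (n.-tuple TR) := [set s | enorm (cV_of_tuple s) <= r]%R.

Lemma measurable_eball (r : R) : measurable (eball r).
Proof.
rewrite -[X in measurable X]setTI.
rewrite (_ : eball r = (fun s : n.-tuple TR => enorm (cV_of_tuple s)) @^-1`
  [set` `]-oo, r]%R]); first exact: measurable_enorm.
by apply/seteqP; split => s; rewrite /= in_itv.
Qed.

(** For [r > 0], the homothety of ratio [1 / r] is a triangular change of variables carrying the
    ball of radius [r] to the unit ball. *)
Lemma power_lebesgue_ball (r : R) : (0 <= r)%R ->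
  pow n (eball r) = (r ^+ n)%:E * pow n (eball 1).
Proof.
rewrite le_eqVlt => /predU1P[<-|r0].
  (* At radius 0 the ball is a point: of full measure for [n = 0], matching [0^0 = 1], and null
     otherwise as a degenerate cube. *)
  have [n0|n0] := posnP n.
    have -> : (0 ^+ n = 1 :> R)%R by rewrite n0.
    have e0 (s : n.-tuple TR) : (enorm (cV_of_tuple s) = 0)%R.
      rewrite (_ : cV_of_tuple s = 0)%R ?enorm0//.
      by apply/colP => i; have := ltn_ord i; rewrite [X in (_ < X)%N]n0.
    by rewrite mul1e; congr (pow n _); apply/seteqP; split => s _; rewrite /eball/= e0.
  have z : (0 ^+ n = 0 :> R)%R by rewrite expr0n gtn_eqF.
  rewrite z mul0e.
  have := @power_lebesgue_cube R n (fun=> 0%R) _ (lexx 0%R).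
  rewrite mulr0 z => h; rewrite -[RHS]h; congr (pow n _).
  apply/seteqP; split => s /=.
    move=> s0 i; rewrite subr0; apply: le_trans s0.
    by have := ler_coord_enorm (cV_of_tuple s) i; rewrite mxE.
  move=> s0; have := @ler_enorm_sum _ _ (cV_of_tuple s) 0%R; rewrite mulr0; apply.
  by move=> i; rewrite mxE -[tnth s i]subr0.
have r'0 : (0 < r^-1)%R by rewrite invr_gt0.
have detr : (\det (r^-1%:M : 'M[R]_n) = r ^- n)%R by rewrite det_scalar exprVn.
have mI : measurable_fun setT (fun s => (\1_(eball 1) s)%:E : \bar R).
  apply/measurable_EFinP; apply: measurable_indic; exact: measurable_eball.
have dpos : (0 < \det (r^-1%:M : 'M[R]_n))%R by rewrite detr invr_gt0 exprn_gt0.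
have I0 s : 0 <= (\1_(eball 1) s)%:E :> \bar R by rewrite lee_fin.
have := ge0_integral_upper_affine 0 (nonneg_upper_scalar n (ltW r'0)) dpos mI I0.
have mI1 := integral_indic (pow n) measurableT (measurable_eball 1).
rewrite detr invrK mI1 setIT => <-.
transitivity (\int[pow n]_s (\1_(eball r) s)%:E).
  have -> := integral_indic (pow n) measurableT (measurable_eball r).
  by rewrite setIT.
apply: eq_integral => s _; congr EFin; rewrite !indicE; congr (_%:R).
have -> : (s \in eball r) = (enorm (cV_of_tuple s) <= r)%R.
  by apply/idP/idP; rewrite inE.
have -> : (affine_tuple (r^-1)%:M 0 s \in eball 1) =
    (enorm (r^-1 *: cV_of_tuple s) <= 1)%R.
  suff E : cV_of_tuple (affine_tuple (r^-1)%:M 0 s) = r^-1 *: cV_of_tuple s.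
    by apply/idP/idP; rewrite inE/= /eball/= E.
  rewrite -mul_scalar_mx; apply/colP => i.
  by rewrite mxE tnth_mktuple mxE [X in (_ + X)%R]mxE addr0.
by rewrite enormZ gtr0_norm// mulrC ler_pdivrMr// mul1r.
Qed.

(* Layer cake: e^-|x| is the integral of e^-r over r >= |x|. *)
Lemma integral_expR_enorm :
  \int[pow n]_s (expR (- enorm (cV_of_tuple s)))%:E =
  (n`!%:R)%:E * lebesgue_cV R n (unit_ball R n).
Proof.
have mB : measurable (@cV_of_tuple R n @^-1` unit_ball R n) := measurable_eball 1.
rewrite lebesgue_cVE//.
rewrite -[_ @^-1` _]/(eball 1).
pose h (z : n.-tuple TR * TR) : \bar R :=
  ((expR (- z.2)) * (\1_[set z | enorm (cV_of_tuple z.1) <= z.2] z))%R%:E.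
have mexp : measurable_fun setT (fun r : TR => expR (- r) : TR).
  exact/measurableT_comp.
have mh : measurable_fun setT h.
  apply/measurable_EFinP/measurable_funM; first exact: measurableT_comp mexp _.
  apply: measurable_indic; rewrite -[X in measurable X]setTI.
  have := @measurable_fun_ler _ (n.-tuple TR * TR)%type R setT
    (fun z => enorm (cV_of_tuple z.1)) (fun z => z.2)
    (measurableT_comp measurable_enorm measurable_fst) measurable_snd.
  by move=> /(_ measurableT [set true]); exact.
have h0 z : 0 <= h z by rewrite lee_fin mulr_ge0// expR_ge0.
transitivity (\int[pow n]_s \int[lam]_r h (s, r)).
  apply: eq_integral => s _.
  have := @integral_exprn_expRN R 0 _ (enorm_ge0 (cV_of_tuple s)).
  rewrite /= opprK => <-; rewrite integral_mkcond.
  apply: eq_integral => r _; rewrite patchE /h/= indicE expr0 mul1r.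
  have -> : (r \in `[enorm (cV_of_tuple s), +oo[%classic) =
      (enorm (cV_of_tuple s) <= r)%R.
    by apply/idP/idP; rewrite inE/= in_itv/= andbT.
  have -> : ((s, r) \in
      [set z : n.-tuple TR * TR | (enorm (cV_of_tuple z.1) <= z.2)%R]) =
     (enorm (cV_of_tuple s) <= r)%R by apply/idP/idP; rewrite inE.
  by case: ifPn => _; rewrite ?mulr1 ?mulr0.
rewrite fubini_tonelli//.
(* After Tonelli, the slice at height [r] is the ball of radius [r], which is empty for negative
   [r]. *)
transitivity
  (\int[lam]_(r in `[0%R, +oo[) ((r ^+ n * expR (- r))%:E * pow n (eball 1))).
  rewrite [RHS]integral_mkcond; apply: eq_integral => r _; rewrite patchE.
  have hE s : h (s, r) = (expR (- r))%:E * (\1_(eball r) s)%:E.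
    by rewrite -EFinM /h !indicE; congr ((_ * _%:R)%R%:E); apply/idP/idP; rewrite !inE.
  under eq_integral do rewrite hE.
  rewrite ge0_integralZl//; last first.
    by apply/measurable_EFinP; apply: measurable_indic; exact: measurable_eball.
  rewrite (integral_indic (pow n) measurableT (measurable_eball r)) setIT.
  have -> : (r \in `[0%R, +oo[%classic) = (0 <= r)%R.
    by apply/idP/idP; rewrite inE/= in_itv/= andbT.
  case: ifPn => r0.
    by rewrite [X in _ * X = _](power_lebesgue_ball r0) muleA -EFinM mulrC.
  suff -> : eball r = set0 by rewrite measure0 mule0.
  rewrite -subset0 => s; rewrite /eball/= => sr.
  by move: r0; rewrite (le_trans _ sr)// enorm_ge0.
rewrite ge0_integralZr//.
- by rewrite integral_exprn_expRN// gamma_primitive0 opprK.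
- apply/measurable_EFinP; apply: measurable_funTS.
  by apply: measurable_funM => //; exact: measurable_funX.
- move=> r /=; rewrite in_itv/= andbT => r0.
  by rewrite lee_fin mulr_ge0 ?expR_ge0 ?exprn_ge0.
Qed.

(** The orthogonal factor [Q] leaves the norm unchanged and makes the linear part upper triangular
    with determinant [|det A|], so the triangular change of variables suffices. *)
Lemma objectiveE (A : affine_iso R n) (t : R) :
  objective A t = ((n`!%:R)%:E * lebesgue_cV R n (unit_ball R n)
             * (expR t / `|affine_det A|)%:E)%E.
Proof.
have [Q oQ uT] := qr_decomposition (affine_lin A).
have uA := affine_lin_unit A.
have detE : \det (Q *m affine_lin A) = `|affine_det A|%R.
  have [d0 _ _ _] := nonneg_upper_detD1 uT.
  by rewrite -(ger0_norm d0) det_mulmx normrM orthogonal_det// mul1r.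
have dpos : (0 < `|affine_det A|)%R by rewrite normr_gt0 -unitfE.
rewrite /objective ge0_integral_lebesgue_cV; first last.
- by move=> x; rewrite lee_fin expR_ge0.
- apply/measurable_EFinP; apply: measurableT_comp => //.
  apply: measurable_funD; last exact: measurable_cst.
  by apply: measurableT_comp => //; exact: measurable_enorm_affine.
transitivity (\int[pow n]_s ((expR t)%:E *
    (expR (- enorm (cV_of_tuple
       (affine_tuple (Q *m affine_lin A) (Q *m affine_trans A) s))))%:E)).
  apply: eq_integral => s _; rewrite -EFinM -expRD addrC; congr (expR (_ - _))%:E.
  rewrite -(orthogonal_enorm _ oQ) /affine_fun mulmxDr mulmxA; congr enorm.
  by apply/colP => i; rewrite [RHS]mxE tnth_mktuple.
have mN : measurable_fun setT (fun s : n.-tuple TR =>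
    (expR (- enorm (cV_of_tuple s)))%:E : \bar R).
  apply/measurable_EFinP; apply: measurableT_comp => //.
  by apply: measurableT_comp => //; exact: measurable_enorm.
rewrite ge0_integralZl//; last first.
  exact: measurableT_comp mN (measurable_affine_tuple _ _).
have dpos' : (0 < \det (Q *m affine_lin A))%R by rewrite detE.
rewrite (ge0_integral_upper_affine _ uT dpos' mN)//.
by rewrite detE integral_expR_enorm muleA -EFinM muleC.
Qed.

End norm_integral.

(** * Packing by cubes and linear growth of [psi] *)

(** Disjoint sets of measure [v] on which [f >= c] each contribute at least [c v] to the integral,
    so fewer than [N] of them fit as soon as [N c v] exceeds it. *)
Lemma integrable_packing d (X : measurableType d) (R : realType)
    (mu : {measure set X -> \bar R}) (f : X -> R) (c v : R) :
  mu.-integrable setT (EFin \o f) -> (forall x, 0 <= f x) -> 0 < c -> 0 < v ->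
  exists N : nat, forall F : nat -> set X,
    (forall i, measurable (F i)) -> trivIset setT F ->
    (forall i, mu (F i) = v%:E) ->
    exists2 i, (i < N)%N & ~ F i `<=` [set x | c <= f x].
Proof.
move=> intf f0 c0 v0.
have mf := measurable_int _ intf.
have If := integrable_fin_num measurableT intf.
pose I := fine (\int[mu]_x (f x)%:E).
pose N := (Num.truncn (I / (c * v))).+1.
have NI : I < N%:R * (c * v).
  by rewrite -ltr_pdivrMr ?mulr_gt0// truncnS_gt.
exists N => F mF tF Fv; apply: contrapT => h.
have FE i : (i < N)%N -> F i `<=` [set x | c <= f x].
  by move=> iN; apply: contrapT => h'; apply: h; exists i.
pose E := \big[setU/set0]_(i < N) F i.
have mE : measurable E by exact: bigsetU_measurable.
have muE : (mu E = (N%:R * v)%:E)%E.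
  rewrite /E measure_semi_additive_ord_I//; last exact: sub_trivIset tF.
  transitivity (\sum_(i < N) v%:E)%E; first by apply: eq_bigr => i _; exact: Fv.
  by rewrite sumEFin sumr_const card_ord mulr_natl.
have : ((c * (N%:R * v))%:E <= \int[mu]_x (f x)%:E)%E.
  apply: (@le_trans _ _ (\int[mu]_(x in E) (f x)%:E)%E); last first.
    by apply: ge0_subset_integral => // x _; rewrite lee_fin.
  rewrite EFinM -muE -integral_cst//; apply: ge0_le_integral => //.
  - by move=> x _; rewrite lee_fin ltW.
  - exact: measurable_funTS.
  - move=> x; rewrite /E -bigcup_mkord => -[i iN Fix].
    by rewrite lee_fin; exact: FE Fix.
by rewrite -(fineK If) lee_fin leNgt mulrCA NI.
Qed.

Section cubes.
Context {R : realType} {n : nat}.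
Local Open Scope ereal_scope.
Notation LV := (caratheodory_type (@borel_lebesgue_cV R n)^*%mu).

Definition cube (a : 'cV[R]_n) (r : R) : set 'cV[R]_n :=
  [set x | forall i, `|x i ord0 - a i ord0| <= r]%R.

Let cubeE (a : 'cV[R]_n) (r : R) : @cV_of_tuple R n @^-1` cube a r =
  [set s | forall i, `|tnth s i - a i ord0| <= r]%R.
Proof. by apply/seteqP; split => s /= h i; have := h i; rewrite mxE. Qed.

Lemma measurable_cube (a : 'cV[R]_n) (r : R) : measurable (cube a r : set LV).
Proof.
by apply: lebesgue_cV_measurable; rewrite cubeE; exact: measurable_power_cube.
Qed.

Lemma lebesgue_cV_cube (a : 'cV[R]_n) (r : R) : (0 <= r)%R ->
  lebesgue_cV R n (cube a r) = ((2 * r) ^+ n)%:E.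
Proof.
move=> r0; rewrite lebesgue_cVE cubeE; last exact: measurable_power_cube.
exact: power_lebesgue_cube.
Qed.

(** The ball lies between two cubes. The inner half-width [1 / (n+1)], rather than [1 / n], also
    covers dimension 0. *)
Lemma unit_ball_volume :
  exists2 V : R, (0 < V)%R & lebesgue_cV R n (unit_ball R n) = V%:E.
Proof.
have mB : measurable (unit_ball R n : set LV).
  by apply: lebesgue_cV_measurable; exact: measurable_eball.
pose r : R := (n.+1%:R^-1)%R.
have r0 : (0 < r)%R by rewrite invr_gt0.
have lo : ((2 * r) ^+ n)%:E <= lebesgue_cV R n (unit_ball R n).
  rewrite -(lebesgue_cV_cube 0%R (ltW r0)).
  apply: le_measure; rewrite ?inE//; first exact: measurable_cube.
  move=> x xr; rewrite /unit_ball/=.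
  apply: (@le_trans _ _ (n%:R * r)%R).
    by apply: ler_enorm_sum => i; have := xr i; rewrite mxE subr0.
  by rewrite /r ler_pdivrMr// mul1r ler_nat.
have hi : lebesgue_cV R n (unit_ball R n) <= ((2 * 1) ^+ n)%:E.
  rewrite -(lebesgue_cV_cube 0%R ler01).
  apply: le_measure; rewrite ?inE//; first exact: measurable_cube.
  by move=> x x1 i; rewrite mxE subr0; apply: le_trans (ler_coord_enorm _ _) x1.
move: lo hi; case: lebesgue_cV => [V| |]//=.
rewrite !lee_fin => lo hi; exists V => //; apply: lt_le_trans lo.
by rewrite exprn_gt0// mulr_gt0.
Qed.

End cubes.

Section growth.
Context {R : realType} {n : nat}.
Variables (f : 'cV[R]_n -> R) (psi : 'cV[R]_n -> \bar R).
Hypothesis f_psi : log_concave_with psi f.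

Lemma convex_efun_le (x y : 'cV[R]_n) (t a b : R) : 0 <= t <= 1 ->
  (psi x <= a%:E)%E -> (psi y <= b%:E)%E ->
  (psi ((1 - t) *: x + t *: y)%R <= ((1 - t) * a + t * b)%:E)%E.
Proof.
have [_ cpsi _] := f_psi => t01 xa yb.
apply: le_trans (cpsi _ _ _ t01) _; rewrite [leRHS]EFinD !EFinM.
have /andP[t0 t1] := t01.
by apply: leeD; apply: lee_wpmul2l => //; rewrite lee_fin ?subr_ge0.
Qed.

(** The mean of [k + 2] points is the convex combination, with weight [1 / (k + 2)] on the last
    point, of that point and the mean of the others. *)
Lemma sublevel_average (M : R) (k : nat) (p : nat -> 'cV[R]_n) :
  (forall i, psi (p i) <= M%:E)%E ->
  (psi (k.+1%:R^-1 *: \sum_(i < k.+1) p i) <= M%:E)%E.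
Proof.
move=> pM; elim: k => [|k IH]; first by rewrite big_ord1 invr1 scale1r.
rewrite big_ord_recr/= scalerDr.
set t : R := k.+2%:R^-1.
have t01 : 0 <= t <= 1 by rewrite invr_ge0 ler0n/= invf_le1 ?ler1n.
have E : t *: \sum_(i < k.+1) p i =
    (1 - t) *: (k.+1%:R^-1 *: \sum_(i < k.+1) p i).
  rewrite scalerA; congr (_ *: _); rewrite /t -[k.+2]addn1 natrD.
  have k0 : 0 <= k%:R :> R by []. field; apply/andP; split; apply: lt0r_neq0; lra.
rewrite E; apply: le_trans (convex_efun_le t01 IH (pM k.+1)) _.
by rewrite -mulrDl subrK mul1r.
Qed.

(** Near an interior point of the support [psi] is finite. Convexity bounds it on short axis
    segments from their endpoints, then on a cube by averaging points of these segments. *)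
Lemma bounded_on_cube (f_nondegenerate : nondegenerate_fun f) :
  exists (x0 : 'cV[R]_n) (r m : R), 0 < r /\ forall x, cube x0 r x -> (psi x <= m%:E)%E.
Proof.
have [psiNy _ fE] := f_psi.
have [x0 x0f] : exists x0 : 'cV[R]_n, interior (supp f) x0 := f_nondegenerate.
have /nbhs_ballP[e /= e0 ef] := x0f.
have fin x : f x != 0 -> exists a, psi x = a%:E.
  move=> fx; have := psiNy x; have := fE x; case: (psi x) => [a| |]//=.
    by exists a.
  by move=> [fx0]; rewrite fx0 eqxx in fx.
pose pt (i : 'I_n) (c : R) : 'cV[R]_n := x0 + c *: delta_mx i ord0.
pose r := e / 2; have r0 : 0 < r by rewrite divr_gt0.
have ptE i c j k : pt i c j k = x0 j k + c * (j == i)%:R.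
  by rewrite !mxE (ord1 k) eqxx andbT.
have ptf i c : `|c| <= r -> f (pt i c) != 0.
  move=> cr; apply: ef; split => // j k; rewrite ptE /ball/=.
  rewrite opprD addNKr normrN.
  apply: (@le_lt_trans _ _ `|c|); last first.
    by apply: le_lt_trans cr _; rewrite /r ltr_pdivrMr//; lra.
  by case: eqVneq => _; rewrite ?mulr1// mulr0 normr0.
(* A sum of absolute values dominates [psi] at the center and at all endpoints simultaneously. *)
pose M := `|fine (psi x0)| +
  \sum_i (`|fine (psi (pt i r))| + `|fine (psi (pt i (- r)))|).
have MD : 0 <= \sum_i (`|fine (psi (pt i r))| + `|fine (psi (pt i (- r)))|).
  by apply: sumr_ge0 => i _; rewrite addr_ge0.
have Mx0 : (psi x0 <= M%:E)%E.
  have [a E] : exists a, psi x0 = a%:E.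
    by apply: fin; apply: ef; exact: ballxx.
  by rewrite E lee_fin /M E/=; apply: le_trans (ler_norm _) _; rewrite lerDl.
have Mi i : (psi (pt i r) <= M%:E)%E /\ (psi (pt i (- r)%R) <= M%:E)%E.
  have [|a E] := fin (pt i r); first by apply: ptf; rewrite ger0_norm// ltW.
  have [|b E'] := fin (pt i (- r)); first by apply: ptf; rewrite normrN ger0_norm// ltW.
  rewrite /M (bigD1 i)//= E E'/= !lee_fin.
  have := normr_ge0 (fine (psi x0)).
  have : 0 <= \sum_(j < n | j != i)
      (`|fine (psi (pt j r))| + `|fine (psi (pt j (- r)))|).
    by apply: sumr_ge0 => j _; rewrite addr_ge0.
  have := ler_norm a; have := ler_norm b.
  have := normr_ge0 a; have := normr_ge0 b.
  by split; lra.
have Mc i c : `|c| <= r -> (psi (pt i c) <= M%:E)%E.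
  rewrite ler_norml => /andP[c1 c2]; have [Mr MNr] := Mi i.
  pose t := (r + c) / (2 * r).
  have t01 : 0 <= t <= 1.
    apply/andP; split; first by apply: divr_ge0; lra.
    by rewrite ler_pdivrMr; lra.
  have -> : pt i c = (1 - t) *: pt i (- r) + t *: pt i r.
    apply/colP => j; rewrite !mxE /t.
    by field; lra.
  apply: le_trans (convex_efun_le t01 MNr Mr) _.
  by rewrite -mulrDl subrK mul1r.
(* Averaging [n + 1] points requires axis displacements [n + 1] times larger than those of [x],
   hence the smaller cube. *)
exists x0, (r / n.+1%:R), M; split; first by rewrite divr_gt0.
move=> x xr.
(* x is the average of x0 and of n points on the axes through x0. *)
pose p k : 'cV[R]_n := if insub k is Some i
  then pt i (n.+1%:R * (x i ord0 - x0 i ord0)) else x0.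
have -> : x = n.+1%:R^-1 *: \sum_(i < n.+1) p i.
  rewrite big_ord_recr/= {2}/p insubF ?ltnn//.
  have -> : \sum_(i < n) p i = n%:R *: x0 + n.+1%:R *: (x - x0).
    apply/colP => j; rewrite summxE.
    rewrite (eq_bigr (fun i : 'I_n => x0 j 0 +
      (n.+1%:R * (x i ord0 - x0 i ord0)) * (j == i)%:R)); last first.
      by move=> i _; rewrite /p valK ptE.
    rewrite big_split/= sumr_const card_ord (bigD1 j)//= eqxx big1 ?addr0.
      by rewrite !mxE mulr1 (mulr_natl (x0 j 0) n).
    by move=> i ij; rewrite eq_sym (negbTE ij) mulr0.
  rewrite addrAC -[X in _ + X + _]scale1r -scalerDl natr1 -scalerDr scalerA.
  by rewrite mulVf ?pnatr_eq0// scale1r addrC subrK.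
apply: sublevel_average => k; rewrite /p; case: insubP => [i _ _|_//].
apply: Mc; rewrite normrM ger0_norm//.
by rewrite -ler_pdivlMl// mulrC; exact: xr.
Qed.

End growth.

Section coercivity.
Context {R : realType} {n : nat}.
Variables (f : 'cV[R]_n -> R) (psi : 'cV[R]_n -> \bar R).
Hypothesis f_psi : log_concave_with psi f.
Hypothesis f_integrable : integrable_fun f.
Variables (x0 : 'cV[R]_n) (r m : R).
Hypothesis r_gt0 : 0 < r.
Hypothesis psi_cube : forall x, cube x0 r x -> (psi x <= m%:E)%E.

(* If y is a far away point of the sublevel set, then the set contains many
   disjoint cubes of half-width r/2 centered on the segment from x0 to y. *)
Lemma sublevel_bounded : exists D : R, forall y,
  (psi y <= (m + 1)%:E)%E -> forall j, `|y j ord0 - x0 j ord0| <= D.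
Proof.
have [_ _ fE] := f_psi.
have f0 x : 0 <= f x by rewrite -lee_fin fE expeR_ge0.
have v0 : 0 < (2 * (r / 2)) ^+ n by rewrite exprn_gt0// mulr_gt0// divr_gt0.
have [N HN] := integrable_packing f_integrable f0 (expR_gt0 (- (m + 1))) v0.
(* With parameters [t k = 2 r k / d] the centers are [2 r] apart in coordinate [j], so cubes of
   half-width [r / 2] are disjoint; [d > 4 r (N + 1)] keeps [t k <= 1 / 2]. *)
exists (4 * r * N.+1%:R) => y yM j; rewrite leNgt; apply/negP => Dlt.
pose d := `|y j ord0 - x0 j ord0|.
have d0 : 0 < d by apply: le_lt_trans Dlt; rewrite !mulr_ge0// ltW.
pose t k : R := 2 * r * k%:R / d.
pose F k := cube (x0 + t k *: (y - x0)) (r / 2).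
have r20 : 0 <= r / 2 by rewrite divr_ge0// ltW.
have [|k kN] := HN F (fun k => measurable_cube _ _) _ (fun k => lebesgue_cV_cube _ r20).
  apply/trivIsetP => k l _ _ kl; rewrite -subset0 => x [].
  move=> /(_ j) h1 /(_ j) h2; move: h1 h2; rewrite !mxE => h1 h2.
  have : `|(t k - t l) * (y j ord0 - x0 j ord0)| <= r.
    rewrite (_ : _ * _ = (x j ord0 - (x0 j ord0 + t l * (y j ord0 - x0 j ord0)))
      - (x j ord0 - (x0 j ord0 + t k * (y j ord0 - x0 j ord0)))); last by ring.
    by apply: le_trans (ler_normB _ _) _; rewrite [leRHS](splitr r) addrC lerD.
  rewrite normrM -/d /t -mulrBl -mulrBr !normrM normfV (gtr0_norm d0).
  rewrite mulrVK ?unitfE ?gt_eqF// (gtr0_norm r_gt0) gtr0_norm//.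
  rewrite leNgt => /negP; apply.
  have : 1 <= `|k%:R - l%:R : R|.
    rewrite -[k%:R]/(k%:~R) -[l%:R]/(l%:~R) -intrB -intr_norm ler1z.
    by rewrite -gtz0_ge1 normr_gt0 subr_eq0 eqz_nat.
  move=> h; apply: (@lt_le_trans _ _ (2 * r)); first by move: r_gt0; lra.
  by rewrite ler_peMr// mulr_ge0// ltW.
apply => x xF.
have tk : 0 <= t k <= 1 / 2.
  apply/andP; split; first by rewrite divr_ge0 ?mulr_ge0// ltW.
  rewrite /t ler_pdivrMr//.
  have : k%:R <= N.+1%:R :> R by rewrite ler_nat ltnW// ltnW// ltnS ltnW.
  move: Dlt; rewrite -/d => h1 h2.
  have : 4 * r * k%:R <= 4 * r * N.+1%:R by rewrite ler_wpM2l// mulr_ge0// ltW.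
  by lra.
have t01 : 0 <= t k <= 1 by lra.
(* The point [q] solves [x = (1 - t k) q + t k y]; as [t k <= 1 / 2], it deviates from [x0] by at
   most [r] in each coordinate. *)
pose q := x0 + (1 - t k)^-1 *: (x - (x0 + t k *: (y - x0))).
have qc : cube x0 r q.
  move=> i; have := xF i; rewrite /q !mxE addrAC subrr add0r normrM => h.
  have tk1 : 0 < 1 - t k by lra.
  rewrite normfV (gtr0_norm tk1) mulrC ler_pdivrMr//.
  by apply: le_trans h _; rewrite (ler_pM2l r_gt0); lra.
have xE : x = (1 - t k) *: q + t k *: y.
  apply/colP => i; rewrite /q !mxE; field; lra.
have psix : (psi x <= (m + 1)%:E)%E.
  have M : m <= m + 1 by lra.
  have qM : (psi q <= (m + 1)%:E)%E by apply: le_trans (psi_cube qc) _; rewrite lee_fin.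
  rewrite xE; apply: le_trans (convex_efun_le f_psi t01 qM yM) _.
  by rewrite -mulrDl subrK mul1r.
have := psix; rewrite -leeN2 -lee_expeR -fE /= lee_fin//.
Qed.

(** On the sphere of radius [D1] about [x0], [psi] exceeds [m + 1] while [psi x0 <= m], so by
    convexity it grows with slope at least [1 / D1] beyond. Within that radius a constant lower
    bound suffices. *)
Lemma linear_growth : exists a b : R, 0 < a /\
  forall x, ((a * enorm (x - x0) - b)%:E <= psi x)%E.
Proof.
have [psiNy _ _] := f_psi.
have [D hD] := sublevel_bounded.
have x0x0 : cube x0 r x0 by move=> i; rewrite subrr normr0 ltW.
have [p0 p0E] : exists p0, psi x0 = p0%:E.
  have := psi_cube x0x0; have := psiNy x0.
  by case: (psi x0) => [p0| |]//; exists p0.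
pose D1 : R := n%:R * `|D| + 1.
have D10 : 0 < D1 by rewrite /D1 ltr_wpDl// mulr_ge0.
(* The weight for which [x0 = (1 - t) x + t q], with [q] the point of the cube opposite to [x]
   chosen below; [L] then solves [p0 = (1 - t) L + t m]. *)
pose t : R := D1 / (D1 + r).
have D1r : 0 < D1 + r by exact: addr_gt0.
have t0 : 0 < t by rewrite divr_gt0.
have t1 : t < 1.
  rewrite /t ltr_pdivrMr//.
  by rewrite mul1r ltrDl.
pose L : R := (p0 - t * m) / (1 - t).
exists D1^-1, (`|m| + `|L| + 1); split; first by rewrite invr_gt0.
move=> x; have := psiNy x; case E : (psi x) => [p| |]// _; last by rewrite leey.
rewrite lee_fin; pose rho : R := enorm (x - x0).
have rho0 : 0 <= rho := enorm_ge0 _.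
have [D1rho|rhoD1] := leP D1 rho.
  have rho_gt0 : 0 < rho by exact: lt_le_trans D1rho.
  pose l : R := D1 / rho.
  have l0 : 0 < l by rewrite divr_gt0.
  have l01 : 0 <= l <= 1.
    by apply/andP; split; [exact: ltW|rewrite ler_pdivrMr// mul1r].
  pose z := (1 - l) *: x0 + l *: x.
  have : ~ (psi z <= (m + 1)%:E)%E.
    move=> /hD zD.
    have : enorm (z - x0) <= n%:R * D.
      apply: ler_enorm_sum => i.
      by have := zD i; rewrite !mxE.
    rewrite (_ : z - x0 = l *: (x - x0)); last first.
      by apply/colP => i; rewrite !mxE; ring.
    rewrite enormZ (gtr0_norm l0) /l divfK ?gt_eqF// /D1 => h.
    have : n%:R * D <= n%:R * `|D| by rewrite ler_wpM2l// ler_norm.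
    by lra.
  have px : (psi x <= p%:E)%E by rewrite E.
  have := convex_efun_le f_psi l01 (psi_cube x0x0) px; rewrite -/z => zp.
  move/negP; rewrite -ltNge => /lt_le_trans/(_ zp); rewrite lte_fin => h.
  have h2 : l^-1 < p - m.
    by rewrite -[ltLHS]mul1r ltr_pdivrMr//; lra.
  move: h2; rewrite /l invf_div mulrC -/rho => h2.
  have := ler_norm (- m); rewrite normrN; have := normr_ge0 L; lra.
have rD : D1^-1 * rho <= 1 by rewrite ler_pdivrMl// mulr1 ltW.
pose q := x0 - (r / D1) *: (x - x0).
have qc : cube x0 r q.
  move=> i; rewrite /q !mxE addrAC subrr add0r normrN normrM.
  rewrite gtr0_norm ?divr_gt0// mulrAC ler_pdivrMr// ler_wpM2l ?(ltW r_gt0)//.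
  apply: le_trans (ltW rhoD1).
  by have := ler_coord_enorm (x - x0) i; rewrite !mxE.
have x0E : x0 = (1 - t) *: x + t *: q.
  apply/colP => i; rewrite /q /t !mxE; field.
  by rewrite !gt_eqF// addr_gt0.
have t01 : 0 <= t <= 1 by apply/andP; split; exact: ltW.
have px : (psi x <= p%:E)%E by rewrite E.
have := convex_efun_le f_psi t01 px (psi_cube qc); rewrite -x0E p0E lee_fin => h.
have Lp : L <= p by rewrite ler_pdivrMr ?subr_gt0//; lra.
have := ler_norm (- L); rewrite normrN; have := normr_ge0 m.
rewrite -/rho; lra.
Qed.

End coercivity.

(** * Existence of a pair of maximal payoff *)

(* The objective function is a positive constant divided by this quantity. *)
Definition payoff (R : realType) (n : nat) (A : affine_iso R n) (t : R) : R :=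
  `|affine_det A| * expR (- t).

Lemma affine_det_gt0 (R : realType) (n : nat) (A : affine_iso R n) :
  0 < `|affine_det A|.
Proof. by rewrite normr_gt0 -unitfE; exact: affine_lin_unit. Qed.

Lemma payoff_gt0 (R : realType) (n : nat) (A : affine_iso R n) (t : R) :
  0 < payoff A t.
Proof. by rewrite mulr_gt0 ?expR_gt0 ?affine_det_gt0. Qed.

(** The common factor [n! vol(B)] is positive and finite, so the comparison can be inverted. *)
Lemma le_objective (R : realType) (n : nat) (A B : affine_iso R n) (t s : R) :
  (objective A t <= objective B s)%E = (payoff B s <= payoff A t).
Proof.
have payE (C : affine_iso R n) u : expR u / `|affine_det C| = (payoff C u)^-1.
  by rewrite /payoff invfM expRN invrK mulrC.
have [V V0 VE] := @unit_ball_volume R n.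
rewrite !objectiveE VE !payE -!EFinM lee_fin.
have c0 : 0 < n`!%:R * V by rewrite mulr_gt0// ltr0n fact_gt0.
by rewrite (ler_pM2l c0) lef_pV2// posrE payoff_gt0.
Qed.

Section existence.
Context {R : realType} {n : nat}.
Variable psi : 'cV[R]_n -> \bar R.
Variables (x0 : 'cV[R]_n) (r m : R).
Hypothesis r_gt0 : 0 < r.
Hypothesis psi_cube : forall x, cube x0 r x -> (psi x <= m%:E)%E.

(** The constraint at [x0] bounds the value [v] there, and the constraint at [x0 + r e_j] then
    bounds the [j]-th column of [T]. *)
Lemma admissible_center (T : 'M[R]_n) (v : 'cV[R]_n) (t : R) :
  (forall x, ((enorm (T *m (x - x0) + v) - t)%:E <= psi x)%E) ->
  [/\ 0 <= m + t, forall i, `|v i ord0| <= m + t &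
      forall i j, `|T i j| <= 2 * (m + t) / r].
Proof.
move=> adm.
have le_cube x : cube x0 r x -> enorm (T *m (x - x0) + v) <= m + t.
  by move=> /psi_cube /(le_trans (adm x)); rewrite lee_fin; lra.
have c0 : cube x0 r x0 by move=> i; rewrite subrr normr0 ltW.
have v_le : enorm v <= m + t by have := le_cube _ c0; rewrite subrr mulmx0 add0r.
have vi i : `|v i ord0| <= m + t by apply: le_trans (ler_coord_enorm _ _) v_le.
split => //; first exact: le_trans (enorm_ge0 _) v_le.
move=> i j; pose y := x0 + r *: delta_mx j ord0.
have cy : cube x0 r y.
  move=> k; rewrite !mxE addrAC subrr add0r eqxx andbT.
  by case: (k == j); rewrite ?mulr1 ?mulr0 ?normr0 ?(ltW r_gt0)// gtr0_norm.
have := le_trans (ler_coord_enorm _ i) (le_cube _ cy).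
rewrite /y addrAC subrr add0r -scalemxAr -colE !mxE => h.
have := ler_normB (r * T i j + v i ord0) (v i ord0); rewrite addrK normrM gtr0_norm//.
by have := vi i; rewrite ler_pdivlMr// mulrC; lra.
Qed.

(** With [u = m + t], the Leibniz formula gives [w <= n! (2 u / r)^n e^(m - u)]; multiplying by [u]
    and using [u^(n+1) <= (n+1)! e^u] bounds [u]. *)
Lemma payoff_bounds_offset (T : 'M[R]_n) (t w : R) :
  0 <= m + t -> (forall i j, `|T i j| <= 2 * (m + t) / r) ->
  0 < w -> w <= `|\det T| * expR (- t) ->
  m + t <= n`!%:R * (2 / r) ^+ n * n.+1`!%:R * expR m / w.
Proof.
move=> u0 Tle w0 wle; set u := m + t in u0 Tle *.
have detT : `|\det T| <= n`!%:R * (2 / r * u) ^+ n.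
  rewrite /determinant; apply: le_trans (ler_norm_sum _ _ _) _.
  have -> : n`!%:R * (2 / r * u) ^+ n = \sum_(s : {perm 'I_n}) (2 / r * u) ^+ n :> R.
    by rewrite sumr_const card_Sn mulr_natl.
  apply: ler_sum => s _; rewrite normrM normrX normrN1 expr1n mul1r normr_prod.
  rewrite -[X in _ ^+ X]card_ord -prodr_const; apply: ler_prod => i _.
  by rewrite normr_ge0/=; apply: le_trans (Tle _ _) _; rewrite mulrAC.
rewrite ler_pdivlMr//; apply: le_trans (ler_wpM2l u0 wle) _.
have -> : - t = m - u by rewrite /u; ring.
rewrite expRD expRN.
have : u ^+ n.+1 / n.+1`!%:R <= expR u.
  by apply: le_trans (expR_ge1Dxn n u0); rewrite lerDr.
have f0 : 0 < n.+1`!%:R :> R by rewrite ltr0n fact_gt0.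
rewrite ler_pdivrMr// => hu.
have eu := expR_gt0 u; have em := expR_gt0 m.
apply: (@le_trans _ _ (u * (n`!%:R * (2 / r * u) ^+ n) * (expR m / expR u))).
  rewrite (mulrA u); apply: ler_wpM2r; first by rewrite divr_ge0// ltW.
  exact: ler_wpM2l.
rewrite mulrA ler_pdivrMr//.
rewrite (_ : u * _ * _ = (n`!%:R * (2 / r) ^+ n * expR m) * u ^+ n.+1); last first.
  by rewrite exprMn exprS; ring.
rewrite (_ : _ * expR m * expR u =
    (n`!%:R * (2 / r) ^+ n * expR m) * (expR u * n.+1`!%:R)); last by ring.
rewrite ler_wpM2l// mulr_ge0 ?(ltW em)// mulr_ge0// exprn_ge0//.
by rewrite divr_ge0// ltW.
Qed.

End existence.

Section continuous_sum.
Context {R : realType} {T : topologicalType} {I : Type}.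
Implicit Types (F : I -> T -> R) (s : seq I).

Lemma continuous_sumr F s : (forall i, continuous (F i)) ->
  continuous (fun x => \sum_(i <- s) F i x).
Proof. by move=> cF; apply: continuous_big => //; exact: add_continuous. Qed.

Lemma continuous_prodr F s : (forall i, continuous (F i)) ->
  continuous (fun x => \prod_(i <- s) F i x).
Proof. by move=> cF; apply: continuous_big => //; exact: mul_continuous. Qed.

End continuous_sum.

Section continuous_real.
Context {R : realType} {T : topologicalType}.
Implicit Types f g : T -> R.

Lemma continuous_addr f g :
  continuous f -> continuous g -> continuous (fun x => f x + g x).
Proof. by move=> cf cg x; apply: cvgD; [exact: cf|exact: cg]. Qed.

Lemma continuous_oppr f : continuous f -> continuous (fun x => - f x).
Proof. by move=> cf x; apply: cvgN; exact: cf. Qed.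

Lemma continuous_mulr f g :
  continuous f -> continuous g -> continuous (fun x => f x * g x).
Proof. by move=> cf cg x; apply: cvgM; [exact: cf|exact: cg]. Qed.

Lemma continuous_cstr (a : R) : continuous (fun _ : T => a).
Proof. by move=> x; exact: cvg_cst. Qed.

Lemma continuous_normr f : continuous f -> continuous (fun x => `|f x|).
Proof. by move=> cf x; apply: cvg_norm; exact: cf. Qed.

Lemma continuous_compr f (h : R -> R) :
  continuous h -> continuous f -> continuous (fun x => h (f x)).
Proof. by move=> ch cf x; apply: continuous_comp; [exact: cf|exact: ch]. Qed.

End continuous_real.

Section maximizer.
Context {R : realType} {n : nat}.
Variable psi : 'cV[R]_n -> \bar R.
Hypothesis psi_Ny : forall x, psi x != -oo%E.
Variables (x0 : 'cV[R]_n) (r m : R).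
Hypothesis r_gt0 : 0 < r.
Hypothesis psi_cube : forall x, cube x0 r x -> (psi x <= m%:E)%E.

(* Triples (T, v, t), standing for x |-> T (x - x0) + v and t, are encoded as
   row vectors, for which the library has the Heine-Borel theorem. *)
Notation code := 'rV[R]_(n * n + (n + 1)).

Let lin (w : code) : 'M[R]_n :=
  \matrix_(i, j) w ord0 (lshift (n + 1) (mxvec_index i j)).
Let ctr (w : code) : 'cV[R]_n := \col_i w ord0 (rshift (n * n) (lshift 1 i)).
Let off (w : code) : R := w ord0 (rshift (n * n) (rshift n ord0)).

Let encode (T : 'M[R]_n) (v : 'cV[R]_n) (t : R) : code :=
  row_mx (mxvec T) (row_mx v^T t%:M).

Let lin_encode T v t : lin (encode T v t) = T.
Proof. by apply/matrixP => i j; rewrite mxE row_mxEl mxvecE. Qed.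

Let ctr_encode T v t : ctr (encode T v t) = v.
Proof.
by apply/colP => i; rewrite mxE row_mxEr row_mxEl mxE; congr (v _ _); rewrite ord1.
Qed.

Let off_encode T v t : off (encode T v t) = t.
Proof. by rewrite /off row_mxEr row_mxEr mxE eqxx. Qed.

Let coord_cont k : continuous (fun w : code => w ord0 k).
Proof. exact: coord_continuous. Qed.

Let cont_det : continuous (fun w => `|\det (lin w)| * expR (- off w)).
Proof.
apply: continuous_mulr.
  apply: continuous_normr; apply: continuous_sumr => s.
  apply: continuous_mulr; first exact: continuous_cstr.
  apply: continuous_prodr => i; under eq_fun do rewrite mxE.
  exact: coord_cont.
apply: continuous_compr; first exact: continuous_expR.
exact/continuous_oppr/coord_cont.
Qed.

Let cont_gauge x : continuous (fun w => enorm (lin w *m (x - x0) + ctr w) - off w).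
Proof.
apply: continuous_addr; last exact/continuous_oppr/coord_cont.
apply: continuous_compr; first exact: sqrt_continuous.
apply: continuous_sumr => i.
suff cE : continuous (fun w => (lin w *m (x - x0) + ctr w) i ord0).
  exact: continuous_mulr.
rewrite (_ : (fun _ => _) = (fun w : code =>
    \sum_j (w ord0 (lshift (n + 1) (mxvec_index i j)) * (x - x0) j ord0) +
    w ord0 (rshift (n * n) (lshift 1 i)))); last first.
  by apply/funext => u; rewrite !mxE; congr (_ + _); apply: eq_bigr => j _; rewrite mxE.
apply: continuous_addr; last exact: coord_cont.
apply: continuous_sumr => j; apply: continuous_mulr; first exact: coord_cont.
exact: continuous_cstr.
Qed.

Let feasible : set code :=
  [set w | forall x, ((enorm (lin w *m (x - x0) + ctr w) - off w)%:E <= psi x)%E].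

Let closed_feasible : closed feasible.
Proof.
rewrite (_ : feasible = \bigcap_x
  [set w | ((enorm (lin w *m (x - x0) + ctr w) - off w)%:E <= psi x)%E]); last first.
  by apply/seteqP; split => w h x //=; exact: h.
apply: closed_bigI => x _; have := psi_Ny x; case E : (psi x) => [a| |]// _.
  rewrite (_ : mkset _ = (fun w => enorm (lin w *m (x - x0) + ctr w) - off w) @^-1`
    [set y | y <= a]).
    by apply: (continuous_closedP _).1; [exact: cont_gauge|exact: closed_le].
  by apply/seteqP; split => w /=; rewrite lee_fin.
rewrite (_ : mkset _ = setT); first exact: closedT.
by apply/seteqP; split => w //= _; rewrite leey.
Qed.

(** Feasible codes with payoff at least that of the given pair form a nonempty compact set, on which
    the continuous payoff attains its maximum; all other admissible pairs have smaller payoff. *)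
Lemma payoff_maximizer (A1 : affine_iso R n) (t1 : R) : admissible psi A1 t1 ->
  exists (A0 : affine_iso R n) (t0 : R), admissible psi A0 t0 /\
    forall B s, admissible psi B s -> payoff B s <= payoff A0 t0.
Proof.
move=> adm1; pose S := feasible `&`
  [set w | payoff A1 t1 <= `|\det (lin w)| * expR (- off w)].
pose code_of (B : affine_iso R n) s :=
  encode (affine_lin B) (affine_fun B x0) s.
have codeS (B : affine_iso R n) s : admissible psi B s ->
    payoff A1 t1 <= payoff B s -> S (code_of B s).
  move=> admB le_B; split; rewrite /feasible/= lin_encode ?ctr_encode off_encode//.
  move=> x; rewrite mulmxBr (_ : _ + _ = affine_fun B x); first exact: admB.
  by rewrite /affine_fun addrA subrK.
have closedS : closed S.
  apply: closedI; first exact: closed_feasible.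
  rewrite (_ : mkset _ = (fun w => `|\det (lin w)| * expR (- off w)) @^-1`
    [set y | payoff A1 t1 <= y])//.
  by apply: (continuous_closedP _).1; [exact: cont_det|exact: closed_ge].
pose K := n`!%:R * (2 / r) ^+ n * n.+1`!%:R * expR m / payoff A1 t1.
(* The summands bound, in turn, the entries of [v], the entries of [T] and, together with [K], the
   offset. *)
pose M := K + 2 * K / r + `|m|.
have compactS : compact S.
  apply: (subclosed_compact closedS
    (rV_compact (A := fun=> `[- M, M]%classic) (fun=> @segment_compact _ _ _))).
  move=> w [feas le_w] k.
  have [u0 vu Tu] := admissible_center r_gt0 psi_cube feas.
  have uK : m + off w <= K by exact: payoff_bounds_offset (payoff_gt0 A1 t1) le_w.
  have r0 : 0 < 2 / r by rewrite divr_gt0.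
  have Kr : 2 / r * (m + off w) <= 2 / r * K by rewrite ler_pM2l.
  have u0r : 0 <= 2 / r * (m + off w) by rewrite mulr_ge0// ltW.
  have K0 : 0 <= K by exact: le_trans uK.
  have m0 := normr_ge0 m.
  suff : `|w ord0 k| <= M by rewrite /= in_itv/= ler_norml.
  rewrite /M (mulrAC 2 K).
  case: (split_ordP k) => p ->.
    case/mxvec_indexP: p => i j; have := Tu i j; rewrite mxE mulrAC => h /=.
    by lra.
  case: (split_ordP p) => i ->.
    by have := vu i; rewrite mxE; lra.
  rewrite (ord1 i) -/(off w).
  have := ler_norm m; have := ler_norm (- m); rewrite normrN.
  by rewrite ler_norml => h1 h2; apply/andP; split; lra.
have [w Sw maxw] := compact_EVT_max (ex_intro _ _ (codeS _ _ adm1 (lexx _))) compactS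
  (continuous_subspaceT cont_det).
have [feas le_w] := set_mem Sw.
(* Codes allow singular matrices, but the payoff at [w] is at least a positive number. *)
have uT : lin w \in unitmx.
  rewrite unitmxE unitfE -normr_gt0.
  rewrite -(pmulr_lgt0 _ (expR_gt0 (- off w))).
  exact: lt_le_trans (payoff_gt0 A1 t1) le_w.
exists (AffineIso (ctr w - lin w *m x0) uT), (off w); split.
  move=> x; rewrite /affine_fun/= addrCA -mulmxBr addrC; exact: feas.
move=> B s admB; have [le_B|/ltW lt_B] := leP (payoff A1 t1) (payoff B s).
  have := maxw _ (mem_set (codeS _ _ admB le_B)).
  by rewrite lin_encode off_encode.
by apply: le_trans lt_B _; exact: le_w.
Qed.

End maximizer.

(** * Improving a pair whose constraint has quadratic slack *)

Lemma bernoulli_ge (R : realType) (n : nat) (x : R) :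
  0 <= x <= 1 -> 1 - n%:R * x <= (1 - x) ^+ n.
Proof.
move=> /andP[x0 x1]; elim: n => [|n IH]; first by rewrite mul0r subr0 expr0.
rewrite exprS; apply: (@le_trans _ _ ((1 - x) * (1 - n%:R * x))).
  rewrite -natr1 -subr_ge0.
  by rewrite (_ : _ - _ = n%:R * (x * x)) ?mulr_ge0//; ring.
by apply: ler_wpM2l => //; rewrite subr_ge0.
Qed.

(** The constraint is void where [psi] is infinite; elsewhere its squared form is the one in which
    the slack is available. *)
Lemma admissible_sq (R : realType) (n : nat) (psi : 'cV[R]_n -> \bar R)
    (A : affine_iso R n) (t : R) :
  (forall x p, psi x = (p - t)%:E -> 0 <= p /\ enorm (A x) ^+ 2 <= p ^+ 2) ->
  (forall x, psi x != -oo%E) -> admissible psi A t.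
Proof.
move=> h psiNy x; have := psiNy x; case E : (psi x) => [q| |]// _.
  have [|p0 hp] := h x (q + t); first by rewrite addrK.
  by rewrite lee_fin lerBlDr enorm_le.
by rewrite leey.
Qed.

Section improvement.
Context {R : realType} {n : nat}.
Variable psi : 'cV[R]_n -> \bar R.
Hypothesis psi_Ny : forall x, psi x != -oo%E.
Variables (B : affine_iso R n) (t : R).
Hypothesis payoff_max : forall C s, admissible psi C s -> payoff C s <= payoff B t.

(* A nonzero row of N gives |y|^2 + (w y_0 + e)^2 <= p^2 in suitable orthonormal
   coordinates y of B x, so B can be stretched by sqrt (1 + w^2) along y_0. *)
Lemma improve_linear (N : 'M[R]_n) (d : 'cV[R]_n) :
  (forall x p, psi x = (p - t)%:E ->
    0 <= p /\ enorm (B x) ^+ 2 + enorm (N *m x + d) ^+ 2 <= p ^+ 2) -> N = 0.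
Proof.
case: n psi psi_Ny B payoff_max N d => [|k] psi' psi'_Ny B' B'_max N d hN.
  by apply/matrixP => -[].
(* Since the linear part of [B'] is invertible, [N x + d] can be rewritten as an affine function of
   [B' x]. *)
have uB := affine_lin_unit B'.
set T := affine_lin B' in uB *.
pose N' := N *m invmx T; pose d' := d - N' *m affine_trans B'.
have NE x : N *m x + d = N' *m B' x + d'.
  rewrite /d' /affine_fun -/T mulmxDr /N' (mulmxA _ T) mulmxKV//.
  by rewrite addrACA subrr addr0.
suff N'0 : N' = 0 by rewrite -(mulmxKV uB N) -/N' N'0 mul0mx.
apply/row_matrixP => i; rewrite row0.
apply: trmx_inj; rewrite trmx0; apply: enorm_eq0.
apply/eqP; rewrite -[_ == _]negbK; apply/negP => w_neq0.
have [H oH Hv] := householder (row i N')^T.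
set w := enorm _ in w_neq0 Hv.
have w0 : 0 < w by rewrite lt_neqAle eq_sym w_neq0 enorm_ge0.
have NiE z : (N' *m z + d') i ord0 = w * (H *m z) ord0 ord0 + d' i ord0.
  have rowE' : row i N' = w *: (delta_mx ord0 ord0 *m H).
    apply: trmx_inj; rewrite linearZ/= trmx_mul trmx_delta.
    by rewrite scalemxAr -Hv mulmxA oH mul1mx.
  rewrite mxE; congr (_ + _).
  transitivity ((row i N' *m z) ord0 ord0); first by rewrite -row_mul [RHS]mxE.
  by rewrite rowE' -scalemxAl -mulmxA -rowE !mxE.
pose K := Num.sqrt (1 + w ^+ 2).
have K2 : K ^+ 2 = 1 + w ^+ 2 by rewrite sqr_sqrtr// addr_ge0// sqr_ge0.
have K1 : 1 < K.
  by rewrite -[ltLHS]sqrtr1 ltr_sqrt ?ltrDl ?exprn_gt0// addr_gt0 ?exprn_gt0.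
have K0 : 0 < K by exact: lt_trans K1.
pose C : 'M[R]_k.+1 := diag_mx (\row_j if j == ord0 then K else 1).
have detC : \det C = K.
  rewrite det_diag big_ord_recl mxE eqxx big1 ?mulr1// => j _.
  by rewrite mxE.
have uC : C *m H *m T \in unitmx.
  rewrite !unitmx_mul uB andbT (orthogonal_unit oH) andbT.
  by rewrite unitmxE unitfE detC gt_eqF.
(* This shift matches the cross terms: [y0^2 + (w y0 + e)^2 - (K y0 + b)^2 = (e / K)^2] with
   [e = d' i ord0]. *)
pose b : R := w * d' i ord0 / K.
pose A := AffineIso (C *m H *m affine_trans B' + b *: delta_mx ord0 ord0) uC.
have AE x : A x = C *m (H *m B' x) + b *: delta_mx ord0 ord0.
  by rewrite /affine_fun/= -/T !mulmxDr !mulmxA addrA.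
have admA : admissible psi' A t.
  apply: admissible_sq psi'_Ny => x p /hN[p0 hp]; split=> //.
  apply: le_trans hp; rewrite -(orthogonal_enorm (B' x) oH).
  have e1 : (w * (H *m B' x) ord0 ord0 + d' i ord0) ^+ 2 <= enorm (N *m x + d) ^+ 2.
    rewrite NE -NiE -(real_normK (num_real _)) ler_sqr ?nnegrE ?enorm_ge0//.
    exact: ler_coord_enorm.
  apply: le_trans (lerD (lexx _) e1).
  rewrite AE /b; move: (H *m B' x) (d' i ord0) => y e.
  rewrite /C mul_diag_mx !enorm_sq !big_ord_recl addrAC; apply: lerD.
    rewrite !mxE !eqxx mulr1 -subr_ge0.
    move: (y ord0 ord0) => y0.
    rewrite (_ : _ - _ = (1 + w ^+ 2 - K ^+ 2) * (y0 ^+ 2) + (e / K) ^+ 2 +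
      (K ^+ 2 - 1 - w ^+ 2) * (e / K) ^+ 2).
      rewrite K2 subrr mul0r add0r (_ : _ - 1 - _ = 0) ?mul0r ?addr0 ?sqr_ge0//.
      by ring.
    by field; rewrite gt_eqF.
  apply: ler_sum => j _; rewrite !mxE /= mul1r.
  by rewrite mulr0 addr0.
have := B'_max _ _ admA; rewrite leNgt => /negP; apply.
rewrite /payoff ltr_pM2r ?expR_gt0// /affine_det/= -/T !det_mulmx !normrM detC.
rewrite (orthogonal_det oH) mulr1 gtr0_norm// ltr_pMl//.
exact: affine_det_gt0.
Qed.

(* With c = |d| and k^2 + a^2 = 1, Cauchy-Schwarz gives
   k |B x| + a c <= sqrt (|B x|^2 + c^2). Replacing (B, t) by (k B, t - a c)
   multiplies the payoff by k^n e^(a c), which exceeds 1 for small a since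
   1 - k is of order a^2. *)
Lemma improve_constant (d : 'cV[R]_n) :
  (forall x p, psi x = (p - t)%:E ->
    0 <= p /\ enorm (B x) ^+ 2 + enorm d ^+ 2 <= p ^+ 2) -> d = 0.
Proof.
move=> hd; apply: enorm_eq0; apply/eqP; rewrite -[_ == _]negbK; apply/negP.
set c := enorm d in hd * => c_neq0.
have c0 : 0 < c by rewrite lt_neqAle eq_sym c_neq0 enorm_ge0.
(* Chosen so that [2 (n + 1) a = c / (1 + c)], which is below both [c] and 1. *)
pose a : R := c / ((1 + c) * (2 * n.+1%:R)).
have c1 : 0 < 1 + c by rewrite addr_gt0.
have n1 : 1 <= n.+1%:R :> R by rewrite ler1n.
have n0 : 0 < n.+1%:R :> R by rewrite ltr0n.
have nn : n%:R = n.+1%:R - 1 :> R by rewrite -natr1 addrK.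
have a0 : 0 < a by rewrite divr_gt0// !mulr_gt0.
have aE : a * (2 * n.+1%:R) = c / (1 + c).
  by rewrite /a invfM (mulrA c) mulfVK// mulf_neq0// gt_eqF.
have a_c : a * (2 * n.+1%:R) < c by rewrite aE ltr_pdivrMr// ltr_pMr// ltrDl.
have a_1 : a * (2 * n.+1%:R) < 1 by rewrite aE ltr_pdivrMr// mul1r ltrDr.
have a1 : a <= 2^-1 by nra.
pose k := Num.sqrt (1 - a ^+ 2).
have k2 : k ^+ 2 = 1 - a ^+ 2 by rewrite sqr_sqrtr//; nra.
have k0 : 0 < k by rewrite sqrtr_gt0; nra.
have uk : k *: affine_lin B \in unitmx.
  by rewrite unitmxZ ?unitfE ?gt_eqF//; exact: affine_lin_unit.
pose A := AffineIso (k *: affine_trans B) uk.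
have admA : admissible psi A (t - a * c).
  apply: admissible_sq psi_Ny => x p; rewrite opprB addrA => E.
  have [] := hd x (p + a * c).
    by rewrite E; congr EFin; ring.
  have -> : A x = k *: B x by rewrite /affine_fun/= scalerDr scalemxAl.
  rewrite enormZ gtr0_norm//.
  set y := enorm (B x); have y0 : 0 <= y := enorm_ge0 _.
  move=> q0 hq.
  have h : k * y + a * c <= p + a * c.
    rewrite -ler_sqr ?nnegrE//; last by rewrite addr_ge0// mulr_ge0// ltW.
    apply: le_trans hq; rewrite -subr_ge0.
    (* Lagrange's identity for the vectors [(k, a)] and [(y, c)], the first of norm 1. *)
    rewrite (_ : _ - _ = (a * y - k * c) ^+ 2 +
        (1 - k ^+ 2 - a ^+ 2) * (y ^+ 2 + c ^+ 2)).
      by rewrite k2 (_ : 1 - _ - _ = 0) ?mul0r ?addr0 ?sqr_ge0//; ring.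
    by ring.
  move: h; rewrite lerD2r => h.
  have ky : 0 <= k * y by rewrite mulr_ge0// ltW.
  have p0 : 0 <= p by exact: le_trans h.
  by rewrite ler_sqr.
have := payoff_max admA; rewrite leNgt => /negP; apply.
have detA : `|affine_det A| = k ^+ n * `|affine_det B|.
  by rewrite /affine_det/= detZ normrM ger0_norm// exprn_ge0// ltW.
rewrite /payoff detA opprB expRD.
rewrite (_ : _ * _ * _ =
    (k ^+ n * expR (a * c)) * (`|affine_det B| * expR (- t))); last by ring.
rewrite ltr_pMl; last by rewrite mulr_gt0 ?expR_gt0 ?affine_det_gt0.
have kn0 : 0 < k ^+ n by rewrite exprn_gt0.
(* Squaring removes the root in [k]. Then [(1 - a^2)^n >= 1 - u] by Bernoulli and
   [e^(a c) >= 1 + a c], while [u < a c / 2] and [u <= 1 / 4]. *)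
rewrite -(@ltr_pXn2r _ 2) ?nnegrE ?ler01 ?mulr_ge0 ?expR_ge0 ?(ltW kn0)//.
rewrite expr1n exprMn -exprM mulnC exprM k2.
have ac0 : 0 < a * c by rewrite mulr_gt0.
pose u := n%:R * a ^+ 2.
have u0 : 0 <= u by rewrite mulr_ge0// sqr_ge0.
have uq : u <= a * (a * (2 * n.+1%:R)) / 2.
  by rewrite /u nn; have := sqr_ge0 a; lra.
have uv : u < a * c / 2.
  by apply: le_lt_trans uq _; rewrite ltr_pM2r// ltr_pM2l.
have u4 : u <= 4^-1.
  apply: le_trans uq _; have : a * (a * (2 * n.+1%:R)) <= a * 1.
    by rewrite ler_pM2l// ltW.
  by lra.
apply: (@lt_le_trans _ _ ((1 - u) * (1 + a * c) ^+ 2)).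
  rewrite -subr_gt0.
  move: (a * c) ac0 uv => v v0 uv; clear -u0 u4 uv v0; nra.
apply: ler_pM.
- by lra.
- exact: sqr_ge0.
- by apply: bernoulli_ge; rewrite sqr_ge0/=; nra.
- rewrite ler_sqr ?nnegrE ?expR_ge0 ?expR_ge1Dx//.
  by rewrite addr_ge0// ltW.
Qed.

End improvement.

(** * Uniqueness up to orthogonal maps *)

Section uniqueness.
Context {R : realType} {n : nat}.
Variable psi : 'cV[R]_n -> \bar R.
Hypothesis psi_Ny : forall x, psi x != -oo%E.
Variables (A1 A2 : affine_iso R n) (t1 t2 : R).
Hypothesis adm1 : admissible psi A1 t1.
Hypothesis adm2 : admissible psi A2 t2.
Hypothesis max1 : forall C s, admissible psi C s -> payoff C s <= payoff A1 t1.
Hypothesis max2 : forall C s, admissible psi C s -> payoff C s <= payoff A2 t2.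

Lemma maximizer_unique : t1 = t2 /\
  exists2 Q : 'M[R]_n, orthogonal_mx Q & forall x, A1 x = Q *m A2 x.
Proof.
have u1 := affine_lin_unit A1.
have [Q oQ] := qr_decomposition (affine_lin A2 *m invmx (affine_lin A1)).
set U := Q *m _ => uU.
have UT : U *m affine_lin A1 = Q *m affine_lin A2.
  by rewrite /U -mulmxA mulmxKV.
have [d0 d1 le_d eq_d] := nonneg_upper_detD1 uU.
set e := \det (1%:M + U) in d1 le_d eq_d.
have e0 : 0 < e by exact: lt_le_trans d1.
have det2 : `|affine_det A2| = \det U * `|affine_det A1|.
  transitivity `|\det (U *m affine_lin A1)|.
    by rewrite UT det_mulmx normrM (orthogonal_det oQ) mul1r.
  by rewrite det_mulmx normrM ger0_norm.
have U0 : 0 < \det U.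
  by have := affine_det_gt0 A2; rewrite det2 pmulr_lgt0// affine_det_gt0.
(* Since [U T1 = Q T2], this is the linear part of [(A1 + Q A2) / 2], with a determinant expressed
   through [1 + U]. *)
pose T : 'M[R]_n := 2^-1 *: ((1%:M + U) *m affine_lin A1).
have detT : \det T = 2^-1 ^+ n * (e * affine_det A1).
  by rewrite detZ det_mulmx.
have uT : T \in unitmx.
  rewrite unitmxE unitfE detT mulf_neq0 ?expf_neq0 ?invr_neq0//.
  by apply: mulf_neq0; [rewrite gt_eqF|rewrite -normr_gt0 affine_det_gt0].
pose B := AffineIso (2^-1 *: (affine_trans A1 + Q *m affine_trans A2)) uT.
have BE x : B x = 2^-1 *: (A1 x + Q *m A2 x).
  rewrite /affine_fun/= /T mulmxDl mul1mx UT -scalemxAl -scalerDr; congr (_ *: _).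
  by rewrite mulmxDl mulmxDr mulmxA addrACA.
have adm p x : psi x = p%:E -> enorm (A1 x) <= p + t1 /\ enorm (Q *m A2 x) <= p + t2.
  move=> E; have := adm1 x; have := adm2 x; rewrite E !lee_fin.
  by rewrite (orthogonal_enorm _ oQ); lra.
have admB : admissible psi B ((t1 + t2) / 2).
  move=> x; have := psi_Ny x; case E : (psi x) => [p| |]// _; last by rewrite leey.
  rewrite lee_fin BE enormZ ger0_norm//.
  by have := ler_enormD (A1 x) (Q *m A2 x); have [] := adm _ _ E; lra.
have pay12 : payoff A1 t1 = payoff A2 t2.
  by apply/eqP; rewrite eq_le max1// max2.
have payB : payoff B ((t1 + t2) / 2) =
    2^-1 ^+ n * e * `|affine_det A1| * expR (- ((t1 + t2) / 2)).
  rewrite /payoff /affine_det/= detT !normrM normrX (gtr0_norm e0).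
  by rewrite mulrA ger0_norm.
(* The squared payoff of [B] is at most the product of the two equal maximal payoffs; the
   exponentials cancel because the offset of [B] is the mean. *)
have e_le : e ^+ 2 <= 4 ^+ n * \det U.
  have := max1 admB; rewrite -ler_sqr ?nnegrE ?(ltW (payoff_gt0 _ _))//.
  rewrite [leRHS]expr2 {2}pay12 payB /payoff det2 !exprMn.
  rewrite -[_ ^+ n ^+ 2]exprM mulnC exprM.
  rewrite (_ : 2^-1 ^+ 2 = 4^-1 :> R); last by field.
  rewrite -[expR (- ((t1 + t2) / 2)) ^+ 2]expRM_natl.
  rewrite (_ : 2%:R * - ((t1 + t2) / 2) = - t1 + - t2) ?expRD; last by field.
  set D := `|affine_det A1|; have D0 : 0 < D := affine_det_gt0 A1.
  set E1 := expR _; set E2 := expR _.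
  have E0 : 0 < D ^+ 2 * (E1 * E2) by rewrite mulr_gt0 ?exprn_gt0// mulr_gt0 ?expR_gt0.
  rewrite (_ : _ * _ * _ * _ = 4^-1 ^+ n * e ^+ 2 * (D ^+ 2 * (E1 * E2))); last by ring.
  rewrite (_ : D * E1 * _ = \det U * (D ^+ 2 * (E1 * E2))); last by ring.
  by rewrite ler_pM2r// exprVn ler_pdivrMl// exprn_gt0.
have eqU : 4 ^+ n * \det U = e ^+ 2 by apply/eqP; rewrite eq_le le_d e_le.
have detU := eq_d U0 eqU.
have t12 : t1 = t2.
  move: pay12; rewrite /payoff det2 detU mul1r.
  by move=> /(mulfI (lt0r_neq0 (affine_det_gt0 A1)))/expR_inj/oppr_inj.
split=> //; have payB1 : payoff B t1 = payoff A1 t1.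
  have tE : (t1 + t2) / 2 = t1 by rewrite -t12; field.
  rewrite -[X in payoff B X]tE payB tE /payoff; congr (_ * _).
  rewrite -[RHS]mul1r; congr (_ * _).
  apply/eqP; rewrite -(@eqrXn2 _ 2) ?mulr_ge0 ?exprn_ge0 ?(ltW e0)//.
  rewrite exprMn -eqU detU mulr1 -exprM mulnC exprM -exprMn.
  by rewrite (_ : 2^-1 ^+ 2 * 4 = 1 :> R) ?expr1n//; field.
have maxB C s : admissible psi C s -> payoff C s <= payoff B t1.
  by rewrite payB1; exact: max1.
(* [N] and [d] are the linear and constant parts of [(A1 - Q A2) / 2]; both must vanish. *)
pose N := 2^-1 *: (affine_lin A1 - Q *m affine_lin A2).
pose d := 2^-1 *: (affine_trans A1 - Q *m affine_trans A2).
have NE x : N *m x + d = 2^-1 *: (A1 x - Q *m A2 x).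
  rewrite /N /d -scalemxAl -scalerDr; congr (_ *: _).
  by rewrite /affine_fun mulmxBl mulmxDr mulmxA opprD addrACA.
have hN x p : psi x = (p - t1)%:E ->
    0 <= p /\ enorm (B x) ^+ 2 + enorm (N *m x + d) ^+ 2 <= p ^+ 2.
  move=> /adm; rewrite -t12 subrK => -[h1 h2].
  have p0 : 0 <= p by exact: le_trans (enorm_ge0 _) h1.
  split=> //; rewrite BE NE !enormZ ger0_norm// !exprMn -mulrDr parallelogram.
  by move: h1 h2; rewrite !(enorm_le _ p0); lra.
have N0 := improve_linear psi_Ny maxB hN.
have d_0 : d = 0.
  apply: (improve_constant psi_Ny maxB) => x p /hN[p0].
  by rewrite N0 mul0mx add0r.
exists Q => // x; apply/eqP; rewrite -subr_eq0; apply/eqP.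
apply: (@scalerI _ _ (2^-1 : R)); first by rewrite invr_neq0.
by rewrite -NE N0 d_0 mul0mx addr0 scaler0.
Qed.

End uniqueness.

(** * From maximal payoff to minimal objective *)

Theorem theorem1 (R : realType) (n : nat)
    (f : 'cV[R]_n -> R) (psi : 'cV[R]_n -> \bar R)
    (f_psi : log_concave_with psi f)
    (f_nondegenerate : nondegenerate_fun f)
    (f_integrable : integrable_fun f) :
  exists (A0 : affine_iso R n) (t0 : R),
    [/\ minimizer psi A0 t0,
        objective A0 t0 =
          ((n`!%:R)%:E * lebesgue_cV R n (unit_ball R n)
             * (expR t0 / `|affine_det A0|)%:E)%E &
        forall (A : affine_iso R n) (t : R), minimizer psi A t ->
          t = t0 /\
          exists2 O : 'M[R]_n, orthogonal_mx O & forall x, A x = O *m A0 x].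
Proof.
have [psi_Ny _ _] := f_psi.
have [x0 [r [m [r0 psi_cube]]]] := bounded_on_cube f_psi f_nondegenerate.
have [a [b [a0 growth]]] := linear_growth f_psi f_integrable r0 psi_cube.
have ua : (a%:M : 'M[R]_n) \in unitmx.
  by rewrite unitmxE det_scalar unitfE expf_neq0// gt_eqF.
(* The growth bound [a |x - x0| - b <= psi x] is itself an admissible pair, which starts the
   maximization. *)
have adm1 : admissible psi (AffineIso (- (a *: x0)) ua) b.
  by move=> x; rewrite /affine_fun/= mul_scalar_mx -scalerBr enormZ gtr0_norm.
have [A0 [t0 [adm0 max0]]] := payoff_maximizer psi_Ny r0 psi_cube adm1.
exists A0, t0; split.
- by split=> // B s admB; rewrite le_objective; exact: max0.
- exact: objectiveE.
- move=> A t [admA minA].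
  (* The arbitrary minimizer comes first, so that the orthogonal matrix acts on [A0]. *)
  apply: (maximizer_unique psi_Ny admA adm0 _ max0) => C s /minA.
  by rewrite le_objective.
Qed.
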